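(* Let $\alpha>-1$, $0\le\gamma<2+\alpha$ and $1<p\le q<\infty$. Let $\sigma,\omega$ be weights and put $u=\sigma^{-p'}$. Then there is a constant $C$ depending only on $p,q,\alpha,\gamma$ such that for all $f$, $$\|\mathcal M_{\alpha,\gamma}f\|_{q,\omega,\alpha}\le C[\sigma,\omega]_{\mathcal C_{p,q,\alpha}}[u]_{\mathcal B_{\infty,\alpha}}^{1/q}\|\sigma f\|_{p,\alpha}.$$
   Context: $\mathcal H=\{x+iy:x\in\mathbb R,\ y>0\}$; for $\alpha>-1$, $dV_\alpha(x+iy)=y^\alpha dx\,dy$. A weight is a nonnegative locally integrable function. $\|g\|_{q,\omega,\alpha}=(\int_{\mathcal H}|g|^q\omega dV_\alpha)^{1/q}$, $\|g\|_{p,\alpha}=(\int_{\mathcal H}|g|^pdV_\alpha)^{1/p}$; $p'$ is the conjugate exponent. For $E\subset\mathcal H$, $|E|_{v,\alpha}=\int_Ev\,dV_\alpha$, $|E|_\alpha=\int_EdV_\alpha$. For an interval $I$, $Q_I=\{x+iy:x\in I,0<y<|I|\}$. $\mathcal M_{\alpha,\gamma}f(z)=\sup\{|I|^{-(2+\alpha-\gamma)}\int_{Q_I}|f|dV_\alpha: I\subset\mathbb R\text{ interval}, z\in Q_I\}$, $\mathcal M_\alpha=\mathcal M_{\alpha,0}$, $[v]_{\mathcal B_{\infty,\alpha}}=\sup_I\frac{1}{|Q_I|_{v,\alpha}}\int_{Q_I}\mathcal M_\alpha(v\chi_{Q_I})dV_\alpha$, and $[\sigma,\omega]_{\mathcal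 C_{p,q,\alpha}}=\sup_I|Q_I|_\alpha^{\frac{\gamma}{2+\alpha}-1}\left(\int_{Q_I}\omega dV_\alpha\right)^{1/q}\left(\int_{Q_I}\sigma^{-p'}dV_\alpha\right)^{1/p'}$, suprema over all intervals $I\subset\mathbb R$. *)

(* Defs.v *)
From HB Require Import structures.
From mathcomp Require Import all_boot all_order all_algebra.
From mathcomp Require Import all_classical all_reals all_analysis.
Set Implicit Arguments. Unset Strict Implicit. Unset Printing Implicit Defensive.
Import Order.TTheory GRing.Theory Num.Theory.
Import numFieldNormedType.Exports.
Local Open Scope classical_set_scope.
Local Open Scope ring_scope.

Section Defs.
Variable R : realType.

(* Lebesgue measure on R x R = R^2 (points z = (x, y) = x + iy). *)
Definition leb2 := ((@lebesgue_measure R) \x (@lebesgue_measure R))%E.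

Definition Hplane : set (R * R) := [set z | 0 < z.2].

Definition intV (alpha : R) (E : set (R * R)) (g : R * R -> \bar R) : \bar R :=
  (\int[leb2]_(z in E) (g z * (z.2 `^ alpha)%:E))%E.

Definition QI (a b : R) : set (R * R) :=
  [set z | a <= z.1 <= b /\ 0 < z.2 < b - a].

(* A weight: nonnegative, measurable, locally integrable on H (w.r.t. dV_alpha,
   equivalently w.r.t. Lebesgue measure, on compact subsets of H). *)
Definition weight (alpha : R) (v : R * R -> R) : Prop :=
  (forall z, Hplane z -> 0 <= v z) /\
  measurable_fun Hplane v /\
  (forall K : set (R * R), K `<=` Hplane -> compact K ->
     leb2.-integrable K (fun z => (v z * z.2 `^ alpha)%:E)).

Definition Mag (alpha gamma : R) (f : R * R -> R) (z : R * R) : \bar R :=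
  ereal_sup [set r | exists a b : R, a < b /\ QI a b z /\
     r = (((b - a) `^ (- (2 + alpha - gamma)))%:E *
          intV alpha (QI a b) (fun w => (`|f w|)%:E))%E].

Definition Ma (alpha : R) := Mag alpha 0.

Definition wnorm (alpha q : R) (omega : R * R -> R) (g : R * R -> \bar R) : \bar R :=
  ((intV alpha Hplane (fun z => ((`|g z| `^ q) * (omega z)%:E)%E)) `^ (q^-1))%E.

Definition norm (alpha p : R) (g : R * R -> R) : \bar R :=
  ((intV alpha Hplane (fun z => ((`|g z| `^ p)%:E))) `^ (p^-1))%E.

Definition conj_exp (p : R) : R := p / (p - 1).

Definition upow (p : R) (sigma : R * R -> R) : R * R -> R :=
  fun z => sigma z `^ (- conj_exp p).

(* [sigma, omega]_{C_{p,q,alpha}} (gamma is the fixed parameter of the paper). *)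
Definition Cpq (alpha gamma p q : R) (sigma omega : R * R -> R) : \bar R :=
  ereal_sup [set r | exists a b : R, a < b /\
     r = (((intV alpha (QI a b) (fun _ => 1%E)) `^ (gamma / (2 + alpha) - 1)) *
          ((intV alpha (QI a b) (fun z => (omega z)%:E)) `^ (q^-1)) *
          ((intV alpha (QI a b) (fun z => ((sigma z) `^ (- conj_exp p))%:E))
               `^ ((conj_exp p)^-1)))%E].

Definition Bratio (alpha : R) (v : R * R -> R) (a b : R) : \bar R :=
  let Qv := intV alpha (QI a b) (fun z => (v z)%:E) in
  let num := intV alpha (QI a b) (Ma alpha (fun z => v z * \1_(QI a b) z)) in
  if Qv == +oo%E then +oo%E else (num * ((fine Qv)^-1)%:E)%E.

Definition Binf (alpha : R) (v : R * R -> R) : \bar R :=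
  ereal_sup [set r | exists a b : R, a < b /\ r = Bratio alpha v a b].

End Defs.

(* Main.v *)
(* The maximal function is dominated by its analogues for two dyadic grids whose
   endpoints stay at distance at least a third of the mesh from each other.  Each
   Carleson box is the union of its upper half and of the boxes of its two halves,
   so that, below a fixed root and down to a fixed depth, a dyadic maximal function
   is constant on the pieces of a finite binary tree and its norm becomes a
   weighted sum over that tree.

   On the tree one selects stopping nodes, where the average of [f] more than
   doubles.  They are sparse, so [B_infty] gives the Carleson condition
   [sum_(F in J) u F <= K * u J] with [K] comparable to the [B_infty] constant.
   The [C_(p,q)] condition and Hoelder's inequality bound each stopping term by
   [n^(q-p) * (f F)^p * (u F)^(1-p)], where [n = || sigma f ||_p], and the Carleson
   embedding (proved by a Bellman function argument) sums these up to
   [K * n^q].  The bounds are uniform in the root and in the depth, and Fatou's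
   lemma concludes. *)
Require Import Defs.
From HB Require Import structures.
From mathcomp Require Import all_boot all_order all_algebra.
From mathcomp Require Import all_classical all_reals all_analysis.
From mathcomp Require Import measurable_realfun ring lra.
Import Order.TTheory GRing.Theory Num.Theory.
Import numFieldNormedType.Exports.
Local Open Scope classical_set_scope.
Local Open Scope ring_scope.

(** * Young's and Hoelder's inequalities in tangent form *)

Section PowerMean.
Context {R : realType}.
Implicit Types x m t p : R.

(** One convex function, homogeneous of degree 1, serves twice. Hoelder's inequality reads
    [phi p (f E) (u E) <= F E] with [F] the mass of [|sigma f| ^ p], and the same [phi p] is the
    Bellman function. The fractional factor would spoil the sparseness of stopping nodes if it grew
    down the tree. Written as a power of the side times a true average, it decreases from a box to
    its sons, which is enough. The [B_infty] constant enters linearly, through the Carleson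
    condition alone, and the [C_(p,q)] constant to the power [q]; taking the [q]-th root at the end
    gives the exponents of the theorem. The boxes touch the real line, so their masses need not be
    finite for a weight. Finiteness is read off from finite constants and a finite norm, so infinite
    or zero values are treated apart, under the convention that zero times infinity is zero. The
    maximal functions themselves are never shown measurable: they are compared only through the
    monotonicity of the integral of nonnegative functions. *)

Definition phi p x m : R := x `^ p * m `^ (1 - p).

Lemma phi_ge0 p x m : 0 <= phi p x m.
Proof. by rewrite mulr_ge0 ?powR_ge0. Qed.

(** [phi p] is the supremum over slopes [t] of the linear forms [p t^(p-1) x - (p-1) t^p m]. These
    identities say that the supremum is attained at [t = x / m]. *)
Lemma phi_tangent p x m : 1 < p -> 0 <= x -> 0 < m ->
  (x / m) `^ (p - 1) * x = phi p x m /\ (x / m) `^ p * m = phi p x m.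
Proof.
move=> p1 x0 m0; have mi : 0 <= m^-1 by rewrite invr_ge0 ltW.
have mE a : m^-1 `^ a = m `^ (- a) by rewrite -powR_inv1 ?ltW// -powRrM mulN1r.
split; rewrite /phi powRM// mE.
  by rewrite opprB -[x `^ p](mulr_powRB1 x0); [ring | lra].
rewrite -mulrA; congr (_ * _).
by rewrite powRD ?(gt_eqF m0) ?implybT// powRr1 ?ltW// mulrC.
Qed.

(** Young's inequality for the product of [b * a] and [t^(p-1) / b]. In the application [b] is a
    value of [sigma], so that the last power is a value of [u], and [t] is left free to be optimised
    after integration. *)
Lemma young_tangent p (a b t : R) : 1 < p -> 0 <= a -> 0 < b -> 0 <= t ->
  p * (t `^ (p - 1) * a) <= (b * a) `^ p + (p - 1) * (t `^ p * b `^ (- (p / (p - 1)))).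
Proof.
move=> p1 a0 b0 t0; have q0 : 0 < p / (p - 1) by rewrite divr_gt0; lra.
have E : p^-1 + (p / (p - 1))^-1 = 1 by field; rewrite !gt_eqF//; lra.
have ba : 0 <= b * a by rewrite mulr_ge0// ltW.
have tb : 0 <= t `^ (p - 1) / b by rewrite divr_ge0 ?powR_ge0// ltW.
have p0 : 0 < p by lra.
have := conjugate_powR ba tb p0 q0 E.
have -> : b * a * (t `^ (p - 1) / b) = t `^ (p - 1) * a by field; rewrite gt_eqF.
have bi : 0 <= b^-1 by rewrite invr_ge0 ltW.
rewrite (powRM _ (powR_ge0 t (p - 1)) bi) -powRrM.
have -> : (p - 1) * (p / (p - 1)) = p by field; rewrite gt_eqF//; lra.
rewrite -(powR_inv1 (ltW b0)) -[_ `^ _ `^ (p / _)]powRrM mulN1r => H.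
apply: (le_trans (ler_wpM2l (ltW p0) H)); rewrite mulrDr le_eqVlt; apply/orP; left; apply/eqP.
by field; rewrite !gt_eqF//; lra.
Qed.

(** The choice [b = m^((1-p)/p)] turns the two right-hand terms of [young_tangent] into [phi p x m]
    and [(p-1) t^p m]. *)
Lemma phi_young p x m t : 1 < p -> 0 <= x -> 0 < m -> 0 <= t ->
  p * (t `^ (p - 1) * x) <= phi p x m + (p - 1) * (t `^ p * m).
Proof.
move=> p1 x0 m0 t0.
have b0 : 0 < m `^ ((1 - p) / p) by exact: powR_gt0.
have := @young_tangent p x _ t p1 x0 b0 t0.
rewrite powRM ?powR_ge0// -!powRrM.
have -> : (1 - p) / p * p = 1 - p by field; rewrite gt_eqF//; lra.
have -> : (1 - p) / p * - (p / (p - 1)) = 1.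
  by field; rewrite !gt_eqF//; lra.
by rewrite (powRr1 (ltW m0)) /phi [m `^ _ * _]mulrC.
Qed.

(* Homogeneity and convexity of [phi p]: a form of Hoelder's inequality. *)
Lemma phi_add p x1 x2 x3 m1 m2 m3 : 1 < p -> 0 <= x1 -> 0 <= x2 -> 0 <= x3 ->
  0 < m1 -> 0 < m2 -> 0 < m3 ->
  phi p (x1 + x2 + x3) (m1 + m2 + m3) <= phi p x1 m1 + phi p x2 m2 + phi p x3 m3.
Proof.
move=> p1 x10 x20 x30 m10 m20 m30.
have X0 : 0 <= x1 + x2 + x3 by lra.
have M0 : 0 < m1 + m2 + m3 by lra.
have [E1 E2] := phi_tangent _ _ _ p1 X0 M0.
set t := (_ / _) in E1 E2.
have t0 : 0 <= t by rewrite divr_ge0// ltW.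
have := phi_young _ _ _ _ p1 x10 m10 t0.
have := phi_young _ _ _ _ p1 x20 m20 t0.
have := phi_young _ _ _ _ p1 x30 m30 t0.
nra.
Qed.

(** The tangent plane at [(x, m + d)] lies below [phi p]; evaluate it at [(x, m)]. *)
Lemma phi_drop p x m d : 1 < p -> 0 <= x -> 0 < m -> 0 <= d ->
  phi p x (m + d) + (p - 1) * (d * (x / (m + d)) `^ p) <= phi p x m.
Proof.
move=> p1 x0 m0 d0.
have M0 : 0 < m + d by lra.
have [E1 E2] := phi_tangent _ _ _ p1 x0 M0.
set t := (_ / _) in E1 E2 *.
have t0 : 0 <= t by rewrite divr_ge0// ltW.
have := phi_young _ _ _ _ p1 x0 m0 t0.
nra.
Qed.

End PowerMean.

(** * Stopping nodes and Carleson embedding on an abstract binary tree *)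

Section Tree.
Context {R : realType} {T : Type}.
Variables l r : T -> T.
Implicit Types (J : T) (d : nat) (a b c v : T -> R) (mu lam : R).

(** The sons do not exhaust their parent: for masses of boxes this is the mass of the upper half. *)
Definition tile v J : R := v J - v (l J) - v (r J).

(* The integral over the box [J], against a measure with masses [v], of the running
   maximum of [a] started at [mu] and stopped at depth [d]; see [integral_dymax]. *)
Fixpoint dysum v a d J mu : R :=
  let mu' := Num.max mu (a J) in
  if d is d'.+1 then tile v J * mu' + dysum v a d' (l J) mu' + dysum v a d' (r J) mu'
  else v J * mu'.

(* A node stops when [a] exceeds twice [lam], the value of [a] at the last node that
   stopped above it; [topsum] keeps the first layer of stopping nodes only. *)
Fixpoint stopsum a c d J lam : R :=
  if 2 * lam < a J then
    c J + if d is d'.+1 then stopsum a c d' (l J) (a J) + stopsum a c d' (r J) (a J) else 0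
  else if d is d'.+1 then stopsum a c d' (l J) lam + stopsum a c d' (r J) lam else 0.

Fixpoint topsum a c d J lam : R :=
  if 2 * lam < a J then c J
  else if d is d'.+1 then topsum a c d' (l J) lam + topsum a c d' (r J) lam else 0.

Definition superadd v := forall J, v (l J) + v (r J) <= v J.

Lemma tile_ge0 v J : superadd v -> 0 <= tile v J.
Proof. by move=> /(_ J); rewrite /tile; lra. Qed.

Lemma stopsum_ge0 a c d J lam : (forall J, 0 <= c J) -> 0 <= stopsum a c d J lam.
Proof.
move=> c0; elim: d J lam => [|d IH] J lam /=; case: ifP => _ //; rewrite ?addr_ge0//.
Qed.

Lemma le_stopsum a c b d J lam : (forall J, c J <= b J) ->
  stopsum a c d J lam <= stopsum a b d J lam.
Proof.
move=> cb; elim: d J lam => [|d IH] J lam /=; case: ifP => _ //;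
  rewrite ?lerD// ?addr0//.
Qed.

Lemma stopsumZ a c k d J lam :
  stopsum a (fun I => k * c I) d J lam = k * stopsum a c d J lam.
Proof.
elim: d J lam => [|d IH] J lam /=; case: ifP => _;
  by rewrite ?IH ?mulrDr ?mulr0// mulrDr.
Qed.

Lemma topsum_le a c d J lam : (forall J, 0 <= c J) -> superadd c ->
  topsum a c d J lam <= c J.
Proof.
move=> c0 cs; elim: d J lam => [|d IH] J lam /=; case: ifP => _ //.
by apply: le_trans (cs J); rewrite lerD.
Qed.

Lemma dysumZ v a k d J mu : 0 <= k ->
  dysum v (fun I => k * a I) d J (k * mu) = k * dysum v a d J mu.
Proof.
move=> k0; elim: d J mu => [|d IH] J mu /=; rewrite -maxr_pMr//.
  by rewrite mulrCA.
by rewrite !IH !mulrDr mulrCA.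
Qed.

(** Until a node stops, [a] stays below [2 * lam], so the running maximum is charged to the last
    stopping node at the price [2 ^ q]. The term [lam ^ q * w J] is that charge inside [J], and the
    bound on [mu] is the invariant carried by the induction. *)
Lemma dysum_le_stopsum w a q d J lam mu : 0 < q -> (forall J, 0 <= w J) -> superadd w ->
  (forall J, 0 <= a J) -> 0 <= lam -> mu <= 2 `^ q * lam `^ q ->
  dysum w (fun I => a I `^ q) d J mu
    <= 2 `^ q * (lam `^ q * w J + stopsum a (fun I => w I * a I `^ q) d J lam).
Proof.
move=> q0 w0 ws a0; have q2 : 1 <= 2 `^ q :> R.
  by apply: le_trans (ler_powR _ (ltW q0)); [rewrite powRr0 | lra].
have pw x y : 0 <= x -> x <= y -> x `^ q <= y `^ q.
  by move=> x0 xy; apply: ge0_ler_powR; rewrite ?nnegrE ?(le_trans x0 xy)// ltW.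
have big I (x y : R) : 0 <= x -> y <= 2 `^ q * x `^ q -> 2 * x < a I ->
    Num.max y (a I `^ q) = a I `^ q.
  move=> x0 hmu st; apply/max_idPr/(le_trans hmu); rewrite -powRM//.
  by rewrite pw ?mulr_ge0// ltW.
have small I (x y : R) : 0 <= x -> y <= 2 `^ q * x `^ q -> ~~ (2 * x < a I) ->
    Num.max y (a I `^ q) <= 2 `^ q * x `^ q.
  by move=> x0 hmu st; rewrite ge_max hmu -powRM//= pw// leNgt.
elim: d J lam mu => [|d IH] J lam mu lam0 hmu /=; set M := Num.max _ _; case: ifPn => st.
- have ME : M = a J `^ q by exact: big lam0 hmu st.
  rewrite ME addr0; have := powR_ge0 lam q; have := powR_ge0 (a J) q; have := w0 J.
  move=> H1 H2 H3; rewrite mulrDr.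
  have A : w J * a J `^ q <= 2 `^ q * (w J * a J `^ q) by rewrite ler_peMl// mulr_ge0.
  apply: le_trans A _; rewrite lerDr !mulr_ge0// ?powR_ge0//.
- rewrite addr0 mulrA mulrC ler_wpM2r//.
  exact: small.
- have ME : M = a J `^ q by exact: big lam0 hmu st.
  have le2 : a J `^ q <= 2 `^ q * a J `^ q by rewrite ler_peMl// powR_ge0.
  rewrite ME; have := IH (l J) _ _ (a0 J) le2; have := IH (r J) _ _ (a0 J) le2.
  set X := stopsum _ _ _ _ _; set Y := stopsum _ _ _ _ _ => H1 H2.
  have := tile_ge0 w J ws; rewrite /tile => H3.
  have H4 : (w J - w (l J) - w (r J)) * a J `^ q <=
     2 `^ q * ((w J - w (l J) - w (r J)) * a J `^ q).
    by rewrite ler_peMl// mulr_ge0// powR_ge0.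
  have H5 : 0 <= 2 `^ q * (lam `^ q * w J) by rewrite !mulr_ge0// powR_ge0.
  rewrite !mulrDr in H1 H2 *.
  have -> : 2 `^ q * (w J * a J `^ q) = 2 `^ q * ((w J - w (l J) - w (r J)) * a J `^ q) +
     2 `^ q * (a J `^ q * w (l J)) + 2 `^ q * (a J `^ q * w (r J)) by ring.
  lra.
- have hM : M <= 2 `^ q * lam `^ q by exact: small.
  have := IH (l J) _ _ lam0 hM; have := IH (r J) _ _ lam0 hM.
  set X := stopsum _ _ _ _ _; set Y := stopsum _ _ _ _ _ => H1 H2.
  have H4 : tile w J * M <= (w J - w (l J) - w (r J)) * (2 `^ q * lam `^ q).
    by rewrite ler_wpM2l// tile_ge0.
  rewrite !mulrDr in H1 H2 *.
  have -> : 2 `^ q * (lam `^ q * w J) = (w J - w (l J) - w (r J)) * (2 `^ q * lam `^ q) +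
     2 `^ q * (lam `^ q * w (l J)) + 2 `^ q * (lam `^ q * w (r J)) by ring.
  lra.
Qed.

(* Bellman function proof of the Carleson embedding: [phi p] decreases along
   the tree when its second argument is increased by the Carleson sums. *)
Lemma carleson_embedding a p K (f u F : T -> R) d J lam : 1 < p -> 0 < K -> 0 <= lam ->
  (forall J, 0 <= a J) -> (forall J, 0 <= f J) -> superadd f ->
  (forall J, 0 < u J) -> (forall J, 0 < tile u J) ->
  (forall J, phi p (f J) (u J) <= F J) ->
  (forall J, phi p (tile f J) (tile u J) <= tile F J) ->
  (forall d J lam, 0 <= lam -> stopsum a u d J lam <= K * u J) ->
  stopsum a (fun I => phi p (f I) (u I)) d J lam <=
    2 `^ p * K / (p - 1) * (F J - phi p (f J) (u J + stopsum a u d J lam / K)).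
Proof.
move=> p1 K0 lam0 a0 f0 fs u0 ut Fp Ft CK.
have k0 : 0 < 2 `^ p * K / (p - 1) by rewrite divr_gt0 ?mulr_gt0 ?powR_gt0//; lra.
set k := _ / _ in k0 *.
have u0' I : 0 <= u I by exact/ltW.
(* the gain of [phi_drop] at a stopping node *)
have gain I V : u I <= V -> V + u I / K <= 2 * u I ->
    phi p (f I) (u I) + k * phi p (f I) (V + u I / K) <= k * phi p (f I) V.
  move=> uV V2; have V0 : 0 < V by exact: lt_le_trans uV.
  have d0 : 0 <= u I / K by rewrite divr_ge0// ltW.
  have := phi_drop _ _ _ _ p1 (f0 I) V0 d0.
  set A := phi p _ (_ + _); set B := phi p _ V; set t := (f I / (V + u I / K)) `^ p => H.
  (* Since [V + u I / K <= 2 * u I], the slope at the new point is at least half of [f I / u I]. The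
     drop is thus at least [2^-p * (p-1) / K] times [phi p (f I) (u I)], whence the value of [k]. *)
  have Ht : (f I / u I / 2) `^ p <= t.
    apply: ge0_ler_powR; rewrite ?nnegrE.
    - lra.
    - by rewrite !divr_ge0.
    - by rewrite divr_ge0//; have := u0 I; lra.
    rewrite -mulrA -invfM ler_wpM2l// lef_pV2 ?posrE; have := u0 I; lra.
  have [_ E] := phi_tangent _ _ _ p1 (f0 I) (u0 I).
  have E2 : 2^-1 `^ p = (2 `^ p)^-1 :> R.
    by rewrite -[2^-1]powR_inv1// -powRrM mulN1r powRN.
  move: Ht; rewrite powRM ?divr_ge0// E2 => Ht.
  have : 2 `^ p > 0 :> R by rewrite powR_gt0.
  set s := _ `^ p in Ht E *; set z := 2 `^ p => z0.
  have H1 : k * A + k * ((p - 1) * (u I / K * t)) <= k * B by rewrite -mulrDr ler_pM2l.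
  have : phi p (f I) (u I) <= k * ((p - 1) * (u I / K * t)).
    have -> : k * ((p - 1) * (u I / K * t)) = z * t * u I.
      by rewrite /k /z; field; rewrite !gt_eqF//; lra.
    rewrite -E ler_wpM2r// -(ler_pM2l (x := z^-1)) ?invr_gt0//.
    by rewrite mulrA mulVf ?gt_eqF// mul1r mulrC.
  lra.
elim: d J lam lam0 => [|d IH] J lam lam0.
  have := CK 0%N J lam lam0; rewrite /=; case: ifPn => st; rewrite ?addr0 ?mul0r ?addr0 => C.
    have := gain J (u J) (lexx _); rewrite -ler_pdivrMl// mulrC in C.
    have -> : u J + u J / K <= 2 * u J by lra.
    move=> /(_ isT) H; have : k * phi p (f J) (u J) <= k * F J by rewrite ler_pM2l.
    by rewrite mulrBr; lra.
  by apply: mulr_ge0; [exact: ltW | rewrite subr_ge0].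
(* [phi_add] merges the tile and the two sons. The Carleson sums shift only the second arguments of
   the sons; the tile is not shifted and is paid for by [Ft]. *)
have step lam' : 0 <= lam' -> stopsum a (fun I => phi p (f I) (u I)) d (l J) lam' +
    stopsum a (fun I => phi p (f I) (u I)) d (r J) lam' <=
    k * (F J - phi p (f J) (u J + (stopsum a u d (l J) lam' + stopsum a u d (r J) lam') / K)).
  move=> l0'; have := IH (l J) lam' l0'; have := IH (r J) lam' l0'.
  set X := stopsum _ _ _ (l J) _; set Y := stopsum _ _ _ (r J) _.
  set X' := stopsum _ u _ (l J) _; set Y' := stopsum _ u _ (r J) _ => H1 H2.
  have X0 : 0 <= X' / K by rewrite divr_ge0 ?stopsum_ge0// ltW.
  have Y0 : 0 <= Y' / K by rewrite divr_ge0 ?stopsum_ge0// ltW.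
  have := @phi_add _ p (tile f J) (f (l J)) (f (r J)) (tile u J) (u (l J) + X' / K)
     (u (r J) + Y' / K) p1 (tile_ge0 _ _ fs) (f0 _) (f0 _) (ut _).
  have := u0 (l J); have := u0 (r J) => r0 l0.
  have -> : 0 < u (l J) + X' / K by lra.
  have -> : 0 < u (r J) + Y' / K by lra.
  have -> : tile f J + f (l J) + f (r J) = f J by rewrite /tile; ring.
  have -> : tile u J + (u (l J) + X' / K) + (u (r J) + Y' / K) = u J + (X' + Y') / K.
    by rewrite /tile; ring.
  move=> /(_ isT isT); have := Ft J; rewrite {3}/tile => H3 H4.
  apply: (le_trans (lerD H2 H1)); rewrite -mulrDr ler_pM2l//; lra.
have := CK d.+1 J lam lam0; rewrite /=; case: ifPn => st C; last exact: step.
have := step (a J) (a0 J).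
set X := stopsum _ _ _ (l J) _; set Y := stopsum _ _ _ (r J) _.
set X' := stopsum _ u _ (l J) _ in C *; set Y' := stopsum _ u _ (r J) _ in C * => H.
(* When [J] stops, its own mass is added to the sums of its sons, and the Carleson condition keeps
   the total shift below [u J]. This is the factor 2 required by [gain]. *)
have C' : (u J + (X' + Y')) / K <= u J by rewrite ler_pdivrMr// mulrC.
have Z0 : 0 <= (X' + Y') / K by rewrite divr_ge0 ?addr_ge0 ?stopsum_ge0// ltW.
have := gain J (u J + (X' + Y') / K).
rewrite lerDl Z0; have -> : u J + (X' + Y') / K + u J / K <= 2 * u J by lra.
move=> /(_ isT isT).
have -> : u J + (X' + Y') / K + u J / K = u J + (u J + (X' + Y')) / K by ring.
by rewrite !mulrBr in H *; lra.
Qed.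

(** A weak-type bound: a first stopping node [I] satisfies [2 * lam * m I <= kap I * f I], where
    [kap I] is at most [kap J] because [kap] decreases downwards, and these nodes are disjoint, so
    [f] adds up to at most [f J]. *)
Lemma topsum_half a (kap f m : T -> R) d J lam : 0 <= lam ->
  (forall J, 0 < m J) -> (forall J, 0 <= f J) -> superadd f ->
  (forall J, 0 <= kap J) -> (forall J, kap (l J) <= kap J) -> (forall J, kap (r J) <= kap J) ->
  (forall J, a J = kap J * f J / m J) ->
  2 * lam * topsum a m d J lam <= kap J * f J.
Proof.
move=> lam0 m0 f0 fs k0 kl kr aE.
have st J' : 2 * lam < a J' -> 2 * lam * m J' <= kap J' * f J'.
  by rewrite aE ltr_pdivlMr// => /ltW.
elim: d J => [|d IH] J /=; case: ifPn => h; rewrite ?mulr0 ?mulr_ge0// ?st//.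
have := IH (l J); have := IH (r J); rewrite mulrDr => H1 H2.
apply: (le_trans (lerD H2 H1)).
apply: le_trans (ler_wpM2l (k0 J) (fs J)); rewrite mulrDr.
by rewrite lerD// ler_wpM2r.
Qed.

(* The stopping nodes are sparse: the stopping children of a node carry at most
   half of its [m]-mass, so the running maximum of [u / m] absorbs [u] of all of them. *)
Lemma stopsum_le_dysum a (kap f m u : T -> R) d J lam mu : 0 <= lam -> 0 <= mu ->
  (forall J, 0 < m J) -> superadd m -> (forall J, 0 <= f J) -> superadd f ->
  (forall J, 0 <= kap J) -> (forall J, kap (l J) <= kap J) -> (forall J, kap (r J) <= kap J) ->
  (forall J, a J = kap J * f J / m J) ->
  stopsum a u d J lam <=
   2 * (dysum m (fun I => u I / m I) d J mu - mu * (m J - topsum a m d J lam)).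
Proof.
move=> lam0 mu0 m0 ms f0 fs k0 kl kr aE.
have m0' I : 0 <= m I by exact: ltW.
have a0 I : 0 <= a I by rewrite aE divr_ge0 ?mulr_ge0.
have uM I (z : R) : u I <= m I * Num.max z (u I / m I).
  by rewrite -ler_pdivrMl// mulrC le_max lexx orbT.
(* The subtracted term is the contribution, at height [mu], of the part of [J] outside its first
   stopping nodes. It is reserved to pay for the last stopping node above [J]. *)
elim: d J lam mu lam0 mu0 => [|d IH] J lam mu lam0 mu0 /=; set M := Num.max _ _.
  have := uM J mu; rewrite -/M => h; have h2 : mu <= M by rewrite le_max lexx.
  case: ifPn => _; first by rewrite subrr mulr0; have := mulr_ge0 (m0' J) (le_trans mu0 h2); lra.
  rewrite subr0; have := ler_wpM2l (m0' J) h2; lra.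
have Mmu : mu <= M by rewrite le_max lexx.
have M0 : 0 <= M by exact: le_trans Mmu.
case: ifPn => st.
  have aJ : 0 < a J by apply: le_lt_trans st; rewrite mulr_ge0.
  have := IH (l J) _ _ (ltW aJ) M0; have := IH (r J) _ _ (ltW aJ) M0.
  have := @topsum_half a kap f m d (l J) _ (ltW aJ) m0 f0 fs k0 kl kr aE.
  have := @topsum_half a kap f m d (r J) _ (ltW aJ) m0 f0 fs k0 kl kr aE.
  set X := topsum _ _ _ _ _; set Y := topsum _ _ _ _ _ => T1 T2.
  have half : 2 * (X + Y) <= m J.
    have : a J * (2 * (X + Y)) <= a J * m J.
      have -> : a J * m J = kap J * f J by rewrite aE divfK ?gt_eqF.
      apply: le_trans (ler_wpM2l (k0 J) (fs J)).
      have := ler_wpM2r (f0 (l J)) (kl J); have := ler_wpM2r (f0 (r J)) (kr J).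
      lra.
    by rewrite ler_pM2l.
  have half' : M * (2 * (X + Y)) <= M * m J by rewrite ler_wpM2l.
  have := uM J mu; rewrite -/M subrr mulr0 subr0 /tile.
  lra.
have := IH (l J) _ _ lam0 M0; have := IH (r J) _ _ lam0 M0.
have := topsum_le a m d (l J) lam m0' ms; have := topsum_le a m d (r J) lam m0' ms.
set X := topsum _ _ _ _ _; set Y := topsum _ _ _ _ _ => T1 T2.
have h : mu * (m J - (Y + X)) <= M * (m J - (Y + X)).
  by rewrite ler_wpM2r//; have := ms J; lra.
rewrite /tile; lra.
Qed.

Lemma dysum_power_bound (kap f m u w F : T -> R) p q K D d J :
  let a J := kap J * f J / m J in
  1 < p -> 0 < q -> 0 < K -> 0 <= D ->
  (forall J, 0 < m J) -> superadd m -> (forall J, 0 <= f J) -> superadd f ->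
  (forall J, 0 <= kap J) -> (forall J, kap (l J) <= kap J) -> (forall J, kap (r J) <= kap J) ->
  (forall J, 0 < u J) -> (forall J, 0 < tile u J) ->
  (forall J, phi p (f J) (u J) <= F J) ->
  (forall J, phi p (tile f J) (tile u J) <= tile F J) ->
  (forall J, 0 <= w J) -> superadd w ->
  (forall d J, 2 * dysum m (fun I => u I / m I) d J 0 <= K * u J) ->
  (forall J, w J * a J `^ q <= D * phi p (f J) (u J)) ->
  dysum w (fun I => a I `^ q) d J 0 <= 2 `^ q * (D * (2 `^ p * K / (p - 1) * F J)).
Proof.
move=> a p1 q0 K0 D0 m0 ms f0 fs k0 kl kr u0 ut Fp Ft w0 ws CK wD.
have a0 I : 0 <= a I by rewrite divr_ge0 ?mulr_ge0// ltW.
have CK' d' I lam : 0 <= lam -> stopsum a u d' I lam <= K * u I.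
  move=> lam0; apply: le_trans (CK d' I); have := @stopsum_le_dysum a kap f m u d' I lam 0.
  by rewrite mul0r subr0; exact.
(* Starting from [lam = 0] and [mu = 0], the charge to an ancestor vanishes and the first node where
   [a] is positive stops. *)
have h0 : 0 <= 2 `^ q * 0 `^ q :> R by rewrite mulr_ge0 ?powR_ge0.
apply: le_trans (dysum_le_stopsum _ _ _ _ _ _ _ q0 w0 ws a0 (lexx 0) h0) _.
rewrite powR0 ?gt_eqF// mul0r add0r ler_pM2l ?powR_gt0//.
apply: le_trans (le_stopsum _ _ _ _ _ _ wD) _; rewrite stopsumZ ler_wpM2l//.
apply: le_trans (carleson_embedding _ _ _ _ _ _ _ _ _ p1 K0 (lexx 0) a0 f0 fs u0 ut Fp Ft CK') _.
rewrite ler_wpM2l ?gerBl ?phi_ge0// divr_ge0 ?mulr_ge0 ?powR_ge0//; lra.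
Qed.

End Tree.

Section Integral.
Context {R : realType}.

(** The integral of a nonnegative function is a supremum over the simple functions below it, so
    monotonicity requires no measurability. This is applied to the maximal functions. *)
Lemma ge0_le_integral_nonmeas d (T : measurableType d) (mu : {measure set T -> \bar R})
    (D : set T) (f g : T -> \bar R) :
  (forall x, D x -> 0 <= f x)%E -> (forall x, D x -> f x <= g x)%E ->
  (\int[mu]_(x in D) f x <= \int[mu]_(x in D) g x)%E.
Proof.
move=> f0 fg; rewrite !ge0_integralE//; last first.
  by move=> x Dx; exact: le_trans (f0 _ Dx) (fg _ Dx).
apply: le_ereal_sup => _ [h hf <-]; exists h => // x; apply: le_trans (hf x) _.
by rewrite /patch; case: ifPn => // /set_mem; exact: fg.
Qed.

End Integral.

(** * Dyadic Carleson boxes and truncated dyadic maximal functions *)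

Section Boxes.
Context {R : realType}.
Local Notation node := (R * {posnum R})%type.
Implicit Types (J : node) (d : nat) (z : R * R) (mu : R) (g : R * R -> \bar R).

Definition lson J : node := (J.1, (J.2%:num / 2)%:pos).
Definition rson J : node := (J.1 + J.2%:num / 2, (J.2%:num / 2)%:pos).

(** Half-open horizontally, unlike [QI], so that the upper half and the two sons partition the box
    exactly. *)
Definition box J : set (R * R) := `[J.1, J.1 + J.2%:num[ `*` `]0, J.2%:num[.
Definition top J : set (R * R) := `[J.1, J.1 + J.2%:num[ `*` `[J.2%:num / 2, J.2%:num[.

Lemma boxP J z : box J z <-> J.1 <= z.1 < J.1 + J.2%:num /\ 0 < z.2 < J.2%:num.
Proof. by rewrite /box /= !in_itv. Qed.

Lemma topP J z : top J z <-> J.1 <= z.1 < J.1 + J.2%:num /\ J.2%:num / 2 <= z.2 < J.2%:num.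
Proof. by rewrite /top /= !in_itv. Qed.

Lemma box_split J : box J = top J `|` (box (lson J) `|` box (rson J)).
Proof.
have h0 : 0 < J.2%:num by []. 
apply/seteqP; split=> z; rewrite /setU /= !boxP topP /=.
- move=> [/andP[h1 h2] /andP[h3 h4]].
  case: (leP (J.2%:num / 2) z.2) => h5; first by left; rewrite h1 h2 h4.
  right; case: (ltP z.1 (J.1 + J.2%:num / 2)) => h6; [left|right]; split; apply/andP; split; lra.
- move=> [|[|]] [/andP[h1 h2] /andP[h3 h4]]; split; apply/andP; split; lra.
Qed.

Lemma sub_box_lson J : box (lson J) `<=` box J.
Proof. by rewrite (box_split J) => z; right; left. Qed.

Lemma sub_box_rson J : box (rson J) `<=` box J.
Proof. by rewrite (box_split J) => z; right; right. Qed.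

Lemma sub_top_box J : top J `<=` box J.
Proof. by rewrite (box_split J) => z; left. Qed.

Lemma box_Hplane J : box J `<=` @Hplane R.
Proof. by move=> z /boxP[_ /andP[]]. Qed.

Lemma top_sons J z : top J z -> ~ box (lson J) z /\ ~ box (rson J) z.
Proof.
by move=> /topP[_ /andP[h _]]; split=> /boxP[_ /andP[_ /=]]; rewrite ltNge h.
Qed.

Lemma lson_rson J z : box (lson J) z -> ~ box (rson J) z.
Proof.
by move=> /boxP[/andP[_ /= h] _] /boxP[/andP[/= + _] _]; rewrite leNgt h.
Qed.

Lemma measurable_box J : measurable (box J).
Proof. exact: measurableX. Qed.

Lemma measurable_top J : measurable (top J).
Proof. exact: measurableX. Qed.

Lemma measurable_Hplane : measurable (@Hplane R).
Proof.
have -> : @Hplane R = setT `*` `]0, +oo[.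
  by apply/seteqP; split=> z; rewrite /Hplane /= in_itv /= ?andbT; [split | case].
exact: measurableX.
Qed.

Lemma box_split_disj J : [disjoint top J & box (lson J) `|` box (rson J)] /\
  [disjoint box (lson J) & box (rson J)].
Proof.
split; apply/disj_setPS => z [].
  by move=> /top_sons[h1 h2] [/h1|/h2].
by move=> /lson_rson h /h.
Qed.

Local Notation leb := (@leb2 R).

Lemma integral_box_split g J :
  measurable_fun (box J) g -> (forall z, box J z -> 0 <= g z)%E ->
  (\int[leb]_(z in box J) g z = \int[leb]_(z in top J) g z +
     (\int[leb]_(z in box (lson J)) g z + \int[leb]_(z in box (rson J)) g z))%E.
Proof.
move=> mg g0; have [d1 d2] := box_split_disj J.
rewrite box_split /leb2 ge0_integral_setU//; last 4 first.
- exact: measurable_top.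
- exact: (measurableU _ _ (measurable_box _) (measurable_box _)).
- by rewrite -box_split.
- by rewrite -box_split.
congr (_ + _)%E; rewrite ge0_integral_setU//.
- exact: measurable_box.
- exact: measurable_box.
- apply: measurable_funS mg; first exact: measurable_box.
  rewrite (box_split J); exact: subsetUr.
- by move=> z h; apply: g0; rewrite (box_split J); right.
Qed.

Definition mass g J : R := fine (\int[leb]_(z in box J) g z).

Fixpoint dymax (a : node -> R) d J mu z : R :=
  let mu' := Num.max mu (a J) in
  if d is d'.+1 then
    if z \in box (lson J) then dymax a d' (lson J) mu' z
    else if z \in box (rson J) then dymax a d' (rson J) mu' z
    else mu'
  else mu'.

Lemma dymax_ge_mu a d J mu z : mu <= dymax a d J mu z.
Proof.
elim: d J mu => [|d IH] J mu /=; first by rewrite le_max lexx.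
have h : mu <= Num.max mu (a J) by rewrite le_max lexx.
by case: ifP => _; [|case: ifP => _ //]; exact: le_trans h (IH _ _).
Qed.

Lemma dymax_le a d J mu z X : mu <= X -> box J z ->
  (forall I, box I `<=` box J -> box I z -> a I <= X) -> dymax a d J mu z <= X.
Proof.
elim: d J mu => [|d IH] J mu /= muX Jz aX.
  by rewrite ge_max muX aX.
have MX : Num.max mu (a J) <= X by rewrite ge_max muX aX.
case: ifPn => [/set_mem zl|_].
  by apply: IH => // I /subset_trans/(_ (@sub_box_lson J)); exact: aX.
case: ifPn => [/set_mem zl|_] //.
by apply: IH => // I /subset_trans/(_ (@sub_box_rson J)); exact: aX.
Qed.

Fixpoint desc j J I : Prop :=
  if j is j'.+1 then desc j' (lson J) I \/ desc j' (rson J) I else I = J.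

Lemma desc_sub j J I : desc j J I -> box I `<=` box J.
Proof.
elim: j J => [|j IH] J /=; first by move=> ->.
by move=> [] /IH h; apply: subset_trans h _; [exact: sub_box_lson|exact: sub_box_rson].
Qed.

Lemma dymax_desc a d j J I mu z : (j <= d)%N -> desc j J I -> box I z ->
  a I <= dymax a d J mu z.
Proof.
elim: j d J mu => [|j IH] d J mu jd /=.
  move=> -> _; case: d {jd} => [|d] /=; first by rewrite le_max lexx orbT.
  have h : a J <= Num.max mu (a J) by rewrite le_max lexx orbT.
  by case: ifP => _; [|case: ifP => _ //]; apply: le_trans h (dymax_ge_mu _ _ _ _ _).
case: d jd => // d jd [] dI Iz /=.
  by have /mem_set -> := desc_sub _ _ _ dI _ Iz; exact: IH.
have zr := desc_sub _ _ _ dI _ Iz; rewrite memNset; last by move=> /lson_rson.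
by rewrite mem_set//; exact: IH.
Qed.

Lemma measurable_dymax a d J mu : measurable_fun setT (dymax a d J mu).
Proof.
elim: d J mu => [|d IH] J mu /=; first exact: measurable_cst.
have mb I : measurable_fun setT (fun z => z \in box I).
  apply: (measurable_fun_bool true); rewrite setTI.
  have -> : (fun z => z \in box I) @^-1` [set true] = box I.
    by apply/seteqP; split=> z /=; [exact: set_mem | exact: mem_set].
  exact: measurable_box.
apply: measurable_fun_ifT => //; apply: measurable_fun_ifT => //.
Qed.

Lemma integral_top g J :
  measurable_fun (box J) g -> (forall z, box J z -> 0 <= g z)%E ->
  (\int[leb]_(z in box J) g z < +oo)%E ->
  (\int[leb]_(z in top J) g z = (tile lson rson (mass g) J)%:E)%E.
Proof.
move=> mg g0 fg.
have fin (A : set (R * R)) : measurable A -> A `<=` box J ->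
    (\int[leb]_(z in A) g z \is a fin_num)%E.
  move=> mA AJ; rewrite ge0_fin_numE; last first.
    by apply: integral_ge0 => z /AJ; exact: g0.
  by apply: le_lt_trans fg; apply: ge0_subset_integral => //; exact: measurable_box.
have gen (x y z : \bar R) : x \is a fin_num -> y \is a fin_num -> z \is a fin_num ->
    x = (fine (x + (y + z)) - fine y - fine z)%:E.
  by case: x y z => [x||] [y||] [z||]//= _ _ _; congr EFin; ring.
rewrite /tile /mass (integral_box_split _ _ mg g0); apply: gen; apply: fin.
- exact: measurable_top.
- exact: sub_top_box.
- exact: measurable_box.
- exact: sub_box_lson.
- exact: measurable_box.
- exact: sub_box_rson.
Qed.

(** The bridge to the tree: [dymax] and [dysum] follow the same recursion, the upper half of a box
    contributing a constant times its [tile]. Finiteness of the mass is what allows that tile to be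
    a difference. *)
Lemma integral_dymax g a d J mu :
  measurable_fun (box J) g -> (forall z, box J z -> 0 <= g z)%E ->
  (\int[leb]_(z in box J) g z < +oo)%E -> 0 <= mu ->
  (\int[leb]_(z in box J) ((dymax a d J mu z)%:E * g z) =
   (dysum lson rson (mass g) a d J mu)%:E)%E.
Proof.
elim: d J mu => [|d IH] J mu mg g0 fg mu0 /=.
  have h : 0 <= Num.max mu (a J) by rewrite le_max mu0.
  rewrite ge0_integralZl_EFin//; last exact: measurable_box.
  rewrite [RHS]EFinM muleC /mass fineK//.
  by rewrite ge0_fin_numE// integral_ge0.
set M := Num.max mu (a J).
have M0 : 0 <= M by rewrite le_max mu0.
have sub (A : set (R * R)) : measurable A -> A `<=` box J -> [/\ measurable_fun A g,
     (forall z, A z -> 0 <= g z)%E & (\int[leb]_(z in A) g z < +oo)%E].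
  move=> mA AJ; split; first by apply: measurable_funS mg => //; exact: measurable_box.
    by move=> z /AJ; exact: g0.
  by apply: le_lt_trans fg; apply: ge0_subset_integral => //; exact: measurable_box.
have [m1 p1 f1] := sub _ (measurable_top J) (@sub_top_box J).
have [m2 p2 f2] := sub _ (measurable_box _) (@sub_box_lson J).
have [m3 p3 f3] := sub _ (measurable_box _) (@sub_box_rson J).
rewrite integral_box_split; first last.
- move=> z Jz; rewrite mule_ge0// ?g0// lee_fin.
  exact: le_trans mu0 (dymax_ge_mu a d.+1 J mu z).
- apply: emeasurable_funM => //; apply/measurable_EFinP.
  exact: measurable_funS (measurable_dymax a d.+1 J mu).
transitivity (\int[leb]_(z in top J) (M%:E * g z) +
    (\int[leb]_(z in box (lson J)) ((dymax a d (lson J) M z)%:E * g z) +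
     \int[leb]_(z in box (rson J)) ((dymax a d (rson J) M z)%:E * g z)))%E.
  congr (_ + (_ + _))%E; apply: eq_integral => z.
  - by move=> /set_mem /top_sons[h1 h2]; rewrite !memNset.
  - by move=> zl; rewrite zl.
  - by move=> zr; rewrite memNset ?zr// => /lson_rson; apply; exact: set_mem.
rewrite !IH// ge0_integralZl_EFin//; last exact: measurable_top.
rewrite (integral_top _ _ mg g0 fg).
by rewrite -EFinM -!EFinD mulrC addrA.
Qed.

End Boxes.

(** * The area of a box, and the passage between [QI] and boxes *)

Section Area.
Context {R : realType}.
Implicit Types alpha h : R.

(** For negative [alpha] the integrand is singular at 0, so the fundamental theorem of calculus is
    applied on [[e n, h]] and the intervals increase to []0, h]]. *)
Lemma integral_powR alpha h : -1 < alpha -> 0 < h ->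
  (\int[@lebesgue_measure R]_(y in `]0%R, h[) (y `^ alpha)%:E =
    (h `^ (alpha + 1) / (alpha + 1))%:E)%E.
Proof.
move=> a1 h0; have a0 : 0 < alpha + 1 by lra.
have mpow (D : set R) : measurable_fun D (fun y : R => (y `^ alpha)%:E).
  by apply: measurable_funTS; apply/measurable_EFinP; exact: measurable_powR.
rewrite (@integral_itv_bndo_bndc R (BRight 0)); last exact: mpow.
(* With [n.+2] the inequality [e n < h] is strict already at [n = 0]. *)
pose e n : R := h / n.+2%:R.
have e0 n : 0 < e n by rewrite divr_gt0.
have eh n : e n < h.
  by rewrite ltr_pdivrMr// ltr_pMr// (_ : 1 = 1%:R)// ltr_nat.
have ecvg : e @ \oo --> (0 : R).
  rewrite -[0](mulr0 h); apply: cvgMr => /=.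
  by have := @cvg_harmonic R; rewrite -(cvg_shiftn 1) /=; under eq_fun do rewrite addn1.
pose F : R -> R := (alpha + 1)^-1 \*: (@powR R ^~ (alpha + 1)).
have xp (x : R) : 0 < x -> x \in `]0, +oo[%R by move=> x0; rewrite in_itv/= x0.
have dpow b (x : R) : 0 < x -> derivable (@powR R ^~ b) x 1.
  by move=> /xp; exact: derivable_powR.
have cpow b (x : R) : 0 < x -> {for x, continuous (@powR R ^~ b)}.
  by move=> /(dpow b) /derivable1_diffP /differentiable_continuous.
have dF (x : R) : 0 < x -> derivable F x 1 by move=> /(dpow (alpha + 1)); exact: derivableZ.
have cF (x : R) : 0 < x -> {for x, continuous F}.
  by move=> /dF /derivable1_diffP /differentiable_continuous.
have ftc n : (\int[@lebesgue_measure R]_(y in `[e n, h]) (y `^ alpha)%:E =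
    (F h)%:E - (F (e n))%:E)%E.
  apply: continuous_FTC2 => //.
  - apply: continuous_in_subspaceT => x /set_mem /=; rewrite in_itv/= => /andP[ex _].
    by apply: cpow; exact: lt_le_trans ex.
  - split.
    + by move=> x; rewrite in_itv/= => /andP[ex _]; apply: dF; exact: lt_trans ex.
    + by apply: cvg_at_right_filter; exact: cF.
    + by apply: cvg_at_left_filter; exact: cF.
  - move=> x; rewrite in_itv/= => /andP[ex _]; have x0 := lt_trans (e0 n) ex.
    rewrite derive1E deriveZ; last exact: dpow.
    by rewrite -derive1E powR_derive1 ?xp// addrK /GRing.scale/= mulrA mulVf ?mul1r ?gt_eqF.
have U : \bigcup_n `[e n, h]%classic = `]0, h]%classic.
  apply/seteqP; split=> [x [n _] /=|x /=]; rewrite !in_itv/= => /andP[x0 xh].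
    by rewrite xh (lt_le_trans _ x0).
  have [n _ /(_ n (leqnn n))] := cvgr_lt _ ecvg _ x0.
  by move=> /= ex; exists n => //=; rewrite in_itv/= xh ltW.
have L1 : (\int[@lebesgue_measure R]_(y in `[e n, h]) (y `^ alpha)%:E)%E @[n --> \oo] -->
   (\int[@lebesgue_measure R]_(y in `]0%R, h]) (y `^ alpha)%:E)%E.
  rewrite -U; apply: ge0_nondecreasing_set_cvg_integral => //.
  - move=> m n mn; apply/subsetPset => x /=; rewrite !in_itv/= => /andP[h1 ->].
    rewrite andbT; apply: le_trans h1.
    by rewrite ler_pM2l// lef_pV2 ?posrE// ler_nat.
  - by move=> i; exact: mpow.
  - by move=> i x _; rewrite lee_fin powR_ge0.
have L2 : (\int[@lebesgue_measure R]_(y in `[e n, h]) (y `^ alpha)%:E)%E @[n --> \oo] -->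
   (h `^ (alpha + 1) / (alpha + 1))%:E.
  under eq_fun do rewrite ftc -EFinB.
  apply: cvg_EFin; first by near=> n.
  have -> : h `^ (alpha + 1) / (alpha + 1) = F h - (alpha + 1)^-1 * 0.
    by rewrite mulr0 subr0 /F /GRing.scale/= mulrC.
  apply: cvgB; first exact: cvg_cst.
  apply: cvgMr => /=; have /cvg_at_rightP := powR_cvg0 a0; apply; split=> // n.
by rewrite -(cvg_lim _ L1)// -(cvg_lim _ L2).
Unshelve. all: by end_near. Qed.

Local Notation leb := (@leb2 R).
Local Notation node := (R * {posnum R})%type.

Lemma measurable_Im_powR alpha (D : set (R * R)) :
  measurable_fun D (fun z : R * R => (z.2 `^ alpha)%:E).
Proof.
apply: measurable_funTS; apply/measurable_EFinP.
apply: (@measurableT_comp _ _ _ _ _ _ (@powR R ^~ alpha)).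
  exact: measurable_powR.
exact: measurable_snd.
Qed.

(** The factor [alpha + 1] separates averages over a box from the normalisation by a power of the
    side; it reappears in [hscale], [uavg] and [tree_const]. *)
Lemma integral_box_Im alpha (J : node) : -1 < alpha ->
  (\int[leb]_(z in box J) (z.2 `^ alpha)%:E =
    (J.2%:num `^ (2 + alpha) / (alpha + 1))%:E)%E.
Proof.
move=> a1; rewrite integral_mkcond /leb2 fubini_tonelli1.
- pose k := (J.2%:num `^ (alpha + 1) / (alpha + 1))%:E.
  transitivity (\int[@lebesgue_measure R]_x
      (patch (fun=> 0%E) `[J.1, (J.1 + J.2%:num)%R[ (fun=> k)) x)%E.
    apply: eq_integral => x _; rewrite /fubini_F /patch.
    case: ifPn => [/set_mem xJ|xJ].
      rewrite /k -integral_powR// [RHS]integral_mkcond; apply: eq_integral => y _.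
      rewrite /patch /=; congr (if _ then _ else _).
      by apply/idP/idP => /set_mem h; apply/mem_set; [case: h | split].
    rewrite integral0_eq// => y _; rewrite memNset// => -[h _].
    by move: xJ; rewrite mem_set.
  rewrite -integral_mkcond integral_cst//= lebesgue_measure_itv/= lte_fin ltrDl.
  rewrite gt0// -EFinB -EFinM; congr EFin.
  rewrite addrAC subrr add0r mulrAC; congr (_ / _).
  rewrite -{2}(powRr1 (ltW (gt0 J.2))) -powRD; last by rewrite (gt_eqF (gt0 J.2)) implybT.
  by congr (_ `^ _); ring.
- apply/(measurable_restrictT _ _).1; first exact: measurable_box.
  exact: measurable_Im_powR.
- by move=> z; rewrite /patch; case: ifP => // _; rewrite lee_fin powR_ge0.
Qed.

Lemma measurable_QI (a b : R) : measurable (QI a b).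
Proof.
have -> : QI a b = `[a, b] `*` `]0, b - a[.
  by apply/seteqP; split=> z; rewrite /QI /= !in_itv.
exact: measurableX.
Qed.

Lemma box_sub_QI (J : node) : box J `<=` QI J.1 (J.1 + J.2%:num).
Proof.
move=> z /boxP[/andP[h1 h2] /andP[h3 h4]]; split; first by rewrite h1 ltW.
by rewrite h3 addrAC subrr add0r.
Qed.

Lemma QI_Hplane (a b : R) : QI a b `<=` @Hplane R.
Proof. by move=> z [_ /andP[]]. Qed.

(* [QI] and the half-open box differ by a segment of a vertical line. *)
Lemma integral_QI (g : R * R -> \bar R) (J : node) :
  measurable_fun (@Hplane R) g -> (forall z, Hplane z -> 0 <= g z)%E ->
  (\int[leb]_(z in QI J.1 (J.1 + J.2%:num)) g z = \int[leb]_(z in box J) g z)%E.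
Proof.
move=> mg g0; pose N : set (R * R) := [set J.1 + J.2%:num] `*` setT.
have mN : measurable N by exact: measurableX.
have N0 : leb N = 0%E.
  by rewrite /leb2 product_measure1E//= lebesgue_measure_set1 mul0e.
transitivity (\int[leb]_(z in QI J.1 (J.1 + J.2%:num) `\` N) g z)%E.
  apply: ge0_negligible_integral => //.
  - exact: measurable_QI.
  - apply: measurable_funS mg; last exact: QI_Hplane.
    exact: measurable_Hplane.
  - by move=> z /QI_Hplane; exact: g0.
congr (integral _ _ _); apply/seteqP; split=> z.
  move=> [[/andP[h1 h2] /andP[h3 h4]] nN]; apply/boxP; rewrite h1 h3.
  rewrite addrAC subrr add0r in h4; rewrite h4 lt_neqAle h2 andbT; split=> //.
  by apply/eqP => e; apply: nN; split.
move=> zJ; split; first exact: box_sub_QI.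
by move=> [/= e _]; move/boxP : zJ => []; rewrite e ltxx andbF.
Qed.

End Area.

(** * Measures given by densities, and Hoelder's inequality for them *)

Section Density.
Context {R : realType}.
Local Notation leb := (@leb2 R).
Local Notation node := (R * {posnum R})%type.
Implicit Types (J : node) (g : R * R -> \bar R).

(** Boxes reach the boundary of the half-plane, so finiteness on them does not follow from local
    integrability. *)
Definition box_density g := [/\ measurable_fun (@Hplane R) g,
  (forall z, Hplane z -> 0 <= g z)%E &
  forall J, (\int[leb]_(z in box J) g z < +oo)%E].

Lemma box_density_mfun g (D : set (R * R)) : box_density g -> D `<=` @Hplane R ->
  measurable_fun D g.
Proof. by case=> mg _ _ DH; apply: measurable_funS mg => //; exact: measurable_Hplane. Qed.

Lemma massE g J : box_density g -> (\int[leb]_(z in box J) g z = (mass g J)%:E)%E.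
Proof.
move=> [mg g0 fg]; rewrite fineK// ge0_fin_numE//.
by apply: integral_ge0 => z /box_Hplane; exact: g0.
Qed.

Lemma mass_ge0 g J : box_density g -> 0 <= mass g J.
Proof.
by move=> [mg g0 fg]; apply: fine_ge0; apply: integral_ge0 => z /box_Hplane; exact: g0.
Qed.

Lemma tile_massE g J : box_density g ->
  (\int[leb]_(z in top J) g z = (tile lson rson (mass g) J)%:E)%E.
Proof.
move=> bg; have [mg g0 fg] := bg; apply: integral_top => //.
  by apply: box_density_mfun => //; exact: box_Hplane.
by move=> z /box_Hplane; exact: g0.
Qed.

Lemma superadd_mass g : box_density g -> superadd lson rson (mass g).
Proof.
move=> bg J; have [mg g0 fg] := bg; rewrite -subr_ge0 opprD addrA.
rewrite -lee_fin -(tile_massE _ J bg); apply: integral_ge0 => z.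
by move=> /sub_top_box /box_Hplane; exact: g0.
Qed.

Lemma leb2_top_gt0 J : (0 < leb (top J))%E.
Proof.
have -> : leb (top J) = (lebesgue_measure `[J.1, (J.1 + J.2%:num)%R[%classic *
    lebesgue_measure `[(J.2%:num / 2)%R, J.2%:num[%classic)%E by exact: product_measure1E.
rewrite !lebesgue_measure_itv/= !lte_fin.
have h : 0 < J.2%:num by [].
rewrite ifT; last by lra.
rewrite ifT; last by lra.
rewrite -!EFinB -EFinM lte_fin mulr_gt0//; lra.
Qed.

Lemma ae_leb2_filter : Filter (almost_everywhere leb).
Proof. by rewrite /leb2; exact: _. Qed.

Lemma integral_gt0 g (E : set (R * R)) : measurable E -> E `<=` @Hplane R ->
  measurable_fun (@Hplane R) g -> (forall z, Hplane z -> 0 <= g z)%E ->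
  {ae leb, forall z, Hplane z -> 0 < g z}%E -> (0 < leb E)%E ->
  (0 < \int[leb]_(z in E) g z)%E.
Proof.
move=> mE EH mg g0 gpos lE; rewrite lt0e; apply/andP; split; last first.
  by apply: integral_ge0 => z /EH; exact: g0.
apply/eqP => I0; have mgE : measurable_fun E g.
  by apply: measurable_funS mg => //; exact: measurable_Hplane.
have gabs : (\int[leb]_(z in E) `|g z| = 0)%E.
  by rewrite -I0; apply: eq_integral => z /set_mem /EH zH; rewrite gee0_abs// g0.
have FF := ae_leb2_filter.
pose mu : {measure set _ -> \bar R} := ((@lebesgue_measure R) \x (@lebesgue_measure R))%E.
have gz : ae_eq leb E g (cst 0%E).
  exact/(@ae_eq_integral_abs _ _ _ mu E mE g mgE).
have nE : {ae mu, forall z, ~ E z}.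
  move: gpos gz; apply: filterS2 => z h1 h2 Ez.
  by have := h1 (EH _ Ez); rewrite h2// ltxx.
have nE' : mu.-negligible E by apply: negligibleS nE => z Ez /=; apply.
have E0 : leb E = 0%E by exact/(@negligibleP _ _ _ mu E mE).
by move: lE; rewrite E0 ltxx.
Qed.

Variable alpha : R.

Definition den (v : R * R -> R) (z : R * R) : \bar R := ((v z)%:E * (z.2 `^ alpha)%:E)%E.

Lemma intV_den (E : set (R * R)) v : intV alpha E (fun z => (v z)%:E) = (\int[leb]_(z in E) den v z)%E.
Proof. by []. Qed.

Lemma measurable_den v : measurable_fun (@Hplane R) v -> measurable_fun (@Hplane R) (den v).
Proof.
move=> mv; apply: emeasurable_funM; first exact/measurable_EFinP.
exact: measurable_Im_powR.
Qed.

Lemma den_ge0 v z : 0 <= v z -> (0 <= den v z)%E.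
Proof. by move=> v0; rewrite mule_ge0 ?lee_fin ?powR_ge0. Qed.

Lemma den_gt0 v z : Hplane z -> 0 < v z -> (0 < den v z)%E.
Proof. by move=> zH v0; rewrite mule_gt0// lte_fin powR_gt0. Qed.

Section Hoelder.
Variables (p : R) (s f : R * R -> R) (E : set (R * R)).
Hypotheses (p1 : 1 < p) (mE : measurable E) (EH : E `<=` @Hplane R).
Hypotheses (ms : measurable_fun (@Hplane R) s) (mf : measurable_fun (@Hplane R) f).
Hypothesis s0 : {ae leb, forall z, Hplane z -> 0 < s z}.

Let A := (\int[leb]_(z in E) den (fun z => `|f z|%R) z)%E.
Let U := (\int[leb]_(z in E) den (upow p s) z)%E.
Let F := (\int[leb]_(z in E) den (fun z => (`|s z * f z| `^ p)%R) z)%E.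

Lemma measurable_upow : measurable_fun (@Hplane R) (upow p s).
Proof. exact: (measurableT_comp (measurable_powR _)). Qed.

Lemma measurable_absf : measurable_fun (@Hplane R) (fun z => `|f z|%R).
Proof. exact: measurableT_comp. Qed.

Lemma measurable_sfp : measurable_fun (@Hplane R) (fun z => (`|s z * f z| `^ p)%R).
Proof.
apply: (measurableT_comp (measurable_powR _)).
by apply: measurableT_comp => //; exact: measurable_funM.
Qed.

Let mden v : measurable_fun (@Hplane R) v -> measurable_fun E (den v).
Proof. by move=> mv; apply: measurable_funS (measurable_den _ mv) => //; exact: measurable_Hplane. Qed.

(** Hoelder's inequality before optimisation. It makes sense while [A] may still be infinite:
    [t = 1] then shows that [A] is finite, and the quotient of [A] by [U] gives the sharp form
    [phi_integral]. *)
Lemma young_integral t : 0 <= t ->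
  ((p * t `^ (p - 1))%:E * A <= F + ((p - 1) * t `^ p)%:E * U)%E.
Proof.
move=> t0; have p0 : 0 <= p - 1 by have := p1; lra.
have p0' : 0 <= p by lra.
have c1 : 0 <= p * t `^ (p - 1) by rewrite mulr_ge0 ?powR_ge0.
have c2 : 0 <= (p - 1) * t `^ p by rewrite mulr_ge0 ?powR_ge0.
have dA z : E z -> (0 <= den (fun z => `|f z|%R) z)%E by move=> _; exact: den_ge0.
have dU z : E z -> (0 <= den (upow p s) z)%E by move=> _; apply: den_ge0; exact: powR_ge0.
have dF z : E z -> (0 <= den (fun z => (`|s z * f z| `^ p)%R) z)%E.
  by move=> _; apply: den_ge0; exact: powR_ge0.
have mA := mden _ measurable_absf; have mU := mden _ measurable_upow.
have mF := mden _ measurable_sfp.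
rewrite /A /U /F /leb2 -!ge0_integralZl_EFin// -ge0_integralD//; first last.
- by apply: emeasurable_funM => //; exact: measurable_cst.
- by move=> z Ez; rewrite mule_ge0// ?dU.
apply: ae_ge0_le_integral => //.
- by move=> z Ez; rewrite mule_ge0// dA.
- by apply: emeasurable_funM => //; exact: measurable_cst.
- by move=> z Ez; rewrite adde_ge0// ?dF// mule_ge0// dU.
- by apply: emeasurable_funD => //; apply: emeasurable_funM => //; exact: measurable_cst.
have FF := @ae_leb2_filter.
apply: filterS s0 => z h Ez; have sz := h (EH _ Ez).
rewrite /den -!EFinM -EFinD lee_fin !mulrA -mulrDl ler_wpM2r ?powR_ge0//.
have := young_tangent _ _ _ _ p1 (normr_ge0 (f z)) sz t0.
by rewrite normrM (gtr0_norm sz) /upow /conj_exp !mulrA.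
Qed.

Lemma integral_abs_lty : (F < +oo)%E -> (U < +oo)%E -> (A < +oo)%E.
Proof.
move=> Ff Uf; have := young_integral 1 ler01; rewrite !powR1 !mulr1 => h.
have {}h : (p%:E * A < +oo)%E.
  apply: le_lt_trans h _; apply: lte_add_pinfty => //.
  have U0 : (0 <= U)%E by apply: integral_ge0 => z _; apply: den_ge0; exact: powR_ge0.
  have -> : U = (fine U)%:E by rewrite fineK// ge0_fin_numE.
  by rewrite -EFinM ltry.
have A0 : (0 <= A)%E by apply: integral_ge0 => z _; exact: den_ge0.
move: h A0; case: (A) => [r _ _|h _|//]; first exact: ltry.
by move: h; rewrite gt0_muley// lte_fin; have := p1; lra.
Qed.

Lemma phi_integral : (F < +oo)%E -> (0 < U)%E -> (U < +oo)%E ->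
  phi p (fine A) (fine U) <= fine F.
Proof.
move=> Ff U0 Uf; have Af := integral_abs_lty Ff Uf.
have A0 : (0 <= A)%E by apply: integral_ge0 => z _; exact: den_ge0.
have F0 : (0 <= F)%E by apply: integral_ge0 => z _; apply: den_ge0; exact: powR_ge0.
have [a EA] : exists a, A = a%:E by exists (fine A); rewrite fineK// ge0_fin_numE.
have [u EU] : exists u, U = u%:E by exists (fine U); rewrite fineK// ge0_fin_numE// ltW.
have [c EF] : exists c, F = c%:E by exists (fine F); rewrite fineK// ge0_fin_numE.
move: A0 U0; rewrite EA EU EF /= lee_fin lte_fin => a0 u0.
have [E1 E2] := phi_tangent _ _ _ p1 a0 u0.
have t0 : 0 <= a / u by rewrite divr_ge0// ltW.
have := young_integral _ t0; rewrite EA EU EF -!EFinM -EFinD lee_fin.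
by rewrite -!mulrA E1 E2; lra.
Qed.

End Hoelder.
End Density.

(** * Two shifted dyadic grids *)

Section Cover.
Context {R : realType}.
Local Notation node := (R * {posnum R})%type.
Implicit Types (J : node) (x y : R).

(** The interval from [x] to [y] either stays inside one dyadic interval down to generation [j] or
    is cut by an endpoint of that generation. *)
Lemma descent j J x y : J.1 <= x -> x <= y -> y < J.1 + J.2%:num ->
  (exists I, [/\ desc j J I, I.1 <= x, y < I.1 + I.2%:num & I.2%:num = J.2%:num / 2 ^+ j])
  \/ exists k : nat, x < J.1 + k%:R * (J.2%:num / 2 ^+ j) <= y.
Proof.
move=> + xy; elim: j J => [|j IH] J Jx yJ.
  by left; exists J; rewrite expr0 divr1.
have E : J.2%:num / 2 / 2 ^+ j = J.2%:num / 2 ^+ j.+1 by rewrite exprS invfM mulrA.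
case: (ltP y (J.1 + J.2%:num / 2)) => hy.
  have [[I [dI h1 h2 h3]]|[k hk]] := IH (lson J) Jx hy; last by right; exists k; rewrite -E.
  by left; exists I; split=> //; [left | rewrite -E].
case: (leP (J.1 + J.2%:num / 2) x) => hx.
  have yJ' : y < (rson J).1 + (rson J).2%:num by rewrite /=; lra.
  have [[I [dI h1 h2 h3]]|[k hk]] := IH (rson J) hx yJ'.
    by left; exists I; split=> //; [right | rewrite -E].
  (* The right son starts [2 ^ j] meshes after the left end of [J]. *)
  right; exists (2 ^ j + k)%N; rewrite -E natrD natrX mulrDl addrA.
  suff -> : J.1 + 2 ^+ j * (J.2%:num / 2 / 2 ^+ j) = (rson J).1 by [].
  by rewrite /=; field; rewrite expf_neq0.
right; exists (2 ^ j)%N; rewrite -E natrX.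
suff -> : 2 ^+ j * (J.2%:num / 2 / 2 ^+ j) = J.2%:num / 2 by rewrite hx.
by field; rewrite expf_neq0.
Qed.

(** The roots have length [2^(N+1)] and are shifted from each other by a third of it. At generation
    [j] the shift is [2^j / 3] meshes, never an integer. Both roots exhaust the line as [N]
    grows. *)
Definition grid_root (N : nat) (i : bool) : node :=
  (if i then - (2 ^+ N / 3) else - 2 ^+ N, PosNum (exprn_gt0 N.+1 (@ltr0Sn R 1))).

(* One-third trick: at every scale the endpoints of the two dyadic grids are at
   distance at least a third of the mesh from each other. *)
Lemma grid_cover N x y : x < y -> - (2 ^+ N / 3) <= x -> y < 2 ^+ N ->
  3 * (y - x) < 2 ^+ N.+1 -> (2 ^+ N)^-1 <= 3 * (y - x) ->
  exists i j I, [/\ (j <= N.*2)%N, desc j (grid_root N i) I, I.1 <= x,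
    y < I.1 + I.2%:num & I.2%:num <= 6 * (y - x)].
Proof.
(* The least [j] whose next mesh is at most [3 * (y - x)] has a mesh [eta] between [3 * (y - x)] and
   [6 * (y - x)]. The hypothesis [small] bounds this [j] by [N.*2], and [big] settles the case
   [j = 0]. *)
move=> xy xN yN big small; pose P j := (2 ^+ N.+1 / 2 ^+ j.+1 : R) <= 3 * (y - x).
have e0 k : 0 < 2 ^+ k :> R by rewrite exprn_gt0.
have exP : exists j, P j.
  exists N.*2; rewrite /P -addnn -addnS exprD.
  by rewrite mulrC invfM mulfVK // gt_eqF.
have jN : (ex_minn exP <= N.*2)%N.
  case: ex_minnP => m _; apply; rewrite /P -addnn -addnS exprD.
  by rewrite mulrC invfM mulfVK // gt_eqF.
move: jN; case: ex_minnP => j Pj jmin jN.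
have hj : 3 * (y - x) < 2 ^+ N.+1 / 2 ^+ j.
  case: j Pj jmin jN => [|j] Pj jmin jN; first by rewrite expr0 divr1.
  by rewrite ltNge; apply/negP => /jmin; rewrite ltnn.
have hj' : 2 ^+ N.+1 / 2 ^+ j <= 6 * (y - x).
  by move: Pj; rewrite /P [2 ^+ j.+1]exprS invfM mulrCA => Pj; lra.
set eta := _ / _ in hj hj'.
have yx := ltW xy.
have H i : (grid_root N i).1 <= x -> y < (grid_root N i).1 + 2 ^+ N.+1 ->
  (exists i j I, [/\ (j <= N.*2)%N, desc j (grid_root N i) I, I.1 <= x,
    y < I.1 + I.2%:num & I.2%:num <= 6 * (y - x)]) \/
  exists k : nat, x < (grid_root N i).1 + k%:R * eta <= y.
  move=> h1 h2; have [[I [d1 d2 d3 d4]]|h] := descent j (grid_root N i) x y h1 yx h2.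
    by left; exists i, j, I; split=> //; rewrite d4.
  by right.
have e1 : 2 ^+ N.+1 = 2 * 2 ^+ N :> R by rewrite exprS.
have z0 := e0 N.
(* If both grids failed, each would have an endpoint in []x, y]], and the two would be less than
   [eta / 3] apart. In units of [eta / 3] their distance is an integer, hence 0, and 3 would divide
   [2 ^ j]. *)
have [||//|[k1 /andP[a1 b1]]] := H true; [by rewrite /=; lra | by rewrite /=; lra |].
have [||//|[k0 /andP[a0 b0]]] := H false; [by rewrite /=; lra | by rewrite /=; lra |].
have eta0 : 0 < eta by rewrite divr_gt0.
have zE : 2 ^+ N = 2 ^+ j * eta / 2.
  by rewrite /eta e1; field; rewrite gt_eqF.
move: a1 b1 a0 b0; rewrite /= zE => a1 b1 a0 b0.
have d1 : (2 ^+ j + 3 * k1%:R - 3 * k0%:R) * eta < 1 * eta by lra.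
have d2 : (3 * k0%:R - 2 ^+ j - 3 * k1%:R) * eta < 1 * eta by lra.
rewrite !ltr_pM2r// in d1 d2.
have E1 : (2 ^ j + 3 * k1)%N%:R = 2 ^+ j + 3 * k1%:R :> R by rewrite natrD natrM natrX.
have E0 : (3 * k0)%N%:R = 3 * k0%:R :> R by rewrite natrM.
have l1 : (2 ^ j + 3 * k1 < 3 * k0 + 1)%N.
  by rewrite -(ltr_nat R) [in ltRHS]natrD E1 E0; lra.
have l2 : (3 * k0 < 2 ^ j + 3 * k1 + 1)%N.
  by rewrite -(ltr_nat R) [in ltRHS]natrD E1 E0; lra.
have E : (2 ^ j + 3 * k1 = 3 * k0)%N.
  by apply/eqP; rewrite eqn_leq; move: l1 l2; rewrite !addn1 !ltnS => -> ->.
have : (3 %| 2 ^ j)%N by rewrite -(dvdn_addl _ (dvdn_mulr k1 (dvdnn 3))) E dvdn_mulr.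
by rewrite Euclid_dvdX.
Qed.

End Cover.

(** * The two-weight condition at a single box *)

Section Testing.
Context {R : realType}.

(** With [Y = y / u^(1/p')] one has [Y^p = phi p y u], and the hypothesis on [c] bounds
    [w^(1/q) * x * y] by [c / k0 * Y]. Then [Y^q = Y^(q-p) * Y^p], where the first factor is at most
    [n^(q-p)] because [p <= q]. *)
Lemma testing_real (p q : R) (w u x y c k0 n : R) : 1 < p -> p <= q ->
  0 <= w -> 0 < u -> 0 <= x -> 0 <= y -> 0 < k0 -> 0 <= n ->
  phi p y u <= n `^ p ->
  k0 * x * w `^ q^-1 * u `^ (conj_exp p)^-1 <= c ->
  w * (x * y) `^ q <= (c / k0) `^ q * n `^ (q - p) * phi p y u.
Proof.
move=> p1 pq w0 u0 x0 y0 k00 n0 hn hc.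
have q0 : 0 < q by lra.
have up : 0 < u `^ (conj_exp p)^-1 by exact: powR_gt0.
pose Y := y / u `^ (conj_exp p)^-1.
have Y0 : 0 <= Y by rewrite divr_ge0// ltW.
have Yp : Y `^ p = phi p y u.
  rewrite /Y powRM ?invr_ge0 ?powR_ge0// /phi; congr (_ * _).
  rewrite -powRN -powRrM; congr (_ `^ _); rewrite /conj_exp; field.
  by rewrite !gt_eqF//; lra.
have Yn : Y <= n.
  rewrite leNgt; apply/negP => nY; move: hn; rewrite -Yp leNgt => /negP; apply.
  by apply: gt0_ltr_powR; rewrite ?nnegrE//; lra.
have X : w `^ q^-1 * (x * y) <= c / k0 * Y.
  rewrite /Y; set U := u `^ _ in up hc *.
  have -> : c / k0 * (y / U) = c * y / (k0 * U) by field; rewrite !gt_eqF.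
  by rewrite ler_pdivlMr ?mulr_gt0//; have := ler_wpM2r y0 hc; lra.
have -> : w * (x * y) `^ q = (w `^ q^-1 * (x * y)) `^ q.
  by rewrite [RHS]powRM ?powR_ge0 ?mulr_ge0// -powRrM mulVf ?powRr1// gt_eqF.
apply: le_trans (_ : (c / k0 * Y) `^ q <= _).
  apply: ge0_ler_powR; rewrite ?nnegrE ?(ltW q0)//.
    by rewrite !mulr_ge0 ?powR_ge0.
  by apply: le_trans X; rewrite !mulr_ge0 ?powR_ge0.
have c0 : 0 <= c.
  by apply: le_trans hc; rewrite !mulr_ge0 ?powR_ge0// ltW.
rewrite powRM//; last by rewrite divr_ge0// ltW.
rewrite -mulrA ler_wpM2l ?powR_ge0// -Yp.
have {1}-> : q = (q - p) + p by ring.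
rewrite powRD; last by rewrite subrK gt_eqF.
rewrite ler_wpM2r ?powR_ge0//; apply: ge0_ler_powR; rewrite ?nnegrE//; lra.
Qed.

End Testing.

(** * The uniform bound for one root and one depth, with finite constants *)

Section Setting.
Context {R : realType}.
Local Notation leb := (@leb2 R).
Local Notation node := (R * {posnum R})%type.
Implicit Types (J : node) (d : nat).

Lemma ge0_subset_integral_nonmeas (A D : set (R * R)) (f g : R * R -> \bar R) :
  A `<=` D -> (forall z, A z -> 0 <= f z)%E -> (forall z, D z -> 0 <= g z)%E ->
  (forall z, A z -> f z <= g z)%E ->
  (\int[leb]_(z in A) f z <= \int[leb]_(z in D) g z)%E.
Proof.
move=> AD f0 g0 fg; rewrite -{1}(setIidr AD).
have -> : (\int[leb]_(z in D `&` A) f z = \int[leb]_(z in D) (f \_ A) z)%E.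
  by rewrite /leb2 integral_mkcondr.
apply: ge0_le_integral_nonmeas => z Dz; rewrite /patch; case: ifPn => [/set_mem Az|_] //.
- exact: f0.
- exact: fg.
- exact: g0.
Qed.

Variables (alpha gamma p q : R) (sigma omega f : R * R -> R).
Hypotheses (a1 : -1 < alpha) (g0 : 0 <= gamma) (p1 : 1 < p) (pq : p <= q).
Hypotheses (hs : weight alpha sigma) (hw : weight alpha omega).
Hypothesis spos : {ae leb, forall z, Hplane z -> 0 < sigma z}.
Hypothesis mf : measurable_fun (@Hplane R) f.
Variables (c B n : R).
Hypotheses (hC : Cpq alpha gamma p q sigma omega = c%:E).
Hypotheses (hB : Binf alpha (upow p sigma) = B%:E).
Hypotheses (hn : norm alpha p (fun z => sigma z * f z) = n%:E) (n0 : 0 < n).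

Let U := den alpha (upow p sigma).
Let W := den alpha omega.
Let A := den alpha (fun z => `|f z|).
Let F := den alpha (fun z => `|sigma z * f z| `^ p).
Let L := den alpha (fun=> 1).

Let msig : measurable_fun (@Hplane R) sigma. Proof. by case: hs => _ []. Qed.
Let mome : measurable_fun (@Hplane R) omega. Proof. by case: hw => _ []. Qed.
Let mU : measurable_fun (@Hplane R) U.
Proof. by apply: measurable_den; exact: measurable_upow. Qed.
Let mW : measurable_fun (@Hplane R) W. Proof. exact: measurable_den. Qed.
Let mA : measurable_fun (@Hplane R) A.
Proof. by apply: measurable_den; exact: measurable_absf. Qed.
Let mF : measurable_fun (@Hplane R) F.
Proof. by apply: measurable_den; exact: measurable_sfp. Qed.
Let U0 z : (0 <= U z)%E. Proof. by apply: den_ge0; exact: powR_ge0. Qed.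
Let A0 z : (0 <= A z)%E. Proof. exact: den_ge0. Qed.
Let F0 z : (0 <= F z)%E. Proof. by apply: den_ge0; exact: powR_ge0. Qed.
Let W0 z : Hplane z -> (0 <= W z)%E. Proof. by move=> zH; apply: den_ge0; case: hw => + _; exact. Qed.

Lemma norm_integral : (\int[leb]_(z in @Hplane R) F z = (n `^ p)%:E)%E.
Proof.
have X0 : (0 <= \int[leb]_(z in @Hplane R) F z)%E by exact: integral_ge0.
rewrite -poweR_EFin -hn /norm -poweRrM mulVf ?poweRe1//.
by rewrite gt_eqF//; have := p1; lra.
Qed.

Lemma box_density_F : box_density F.
Proof.
split=> // J; apply: (@le_lt_trans _ _ (n `^ p)%:E); last exact: ltry.
rewrite -norm_integral; apply: ge0_subset_integral => //.
- exact: measurable_box.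
- exact: measurable_Hplane.
- exact: box_Hplane.
Qed.

Lemma mass_F_le J : mass F J <= n `^ p.
Proof.
rewrite -lee_fin -massE; last exact: box_density_F.
rewrite -norm_integral; apply: ge0_subset_integral => //.
- exact: measurable_box.
- exact: measurable_Hplane.
- exact: box_Hplane.
Qed.

Let node_lt J : J.1 < J.1 + J.2%:num. Proof. by rewrite ltrDl. Qed.

Lemma Bratio_le J : (Bratio alpha (upow p sigma) J.1 (J.1 + J.2%:num)%R <= B%:E)%E.
Proof. by rewrite -hB; apply: ereal_sup_ubound; exists J.1, (J.1 + J.2%:num)%R. Qed.

(** [Bratio] is infinite by definition on a box of infinite [u]-mass, which a finite [B]
    excludes. *)
Lemma box_density_U : box_density U.
Proof.
split=> // J; rewrite -integral_QI//.
rewrite ltey; apply/eqP => E; have := Bratio_le J; rewrite /Bratio.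
by rewrite (intV_den alpha (QI _ _) (upow p sigma)) E eqxx.
Qed.

Lemma box_density_A : box_density A.
Proof.
split=> // J; apply: (integral_abs_lty alpha p sigma f (box J) p1) => //.
- exact: measurable_box.
- exact: box_Hplane.
- by case: box_density_F.
- by case: box_density_U.
Qed.

Lemma box_density_L : box_density L.
Proof.
split.
- by apply: measurable_den; exact: measurable_cst.
- by move=> z _; exact: den_ge0.
- move=> J; rewrite /L /den; under eq_integral do rewrite mul1e.
  by rewrite integral_box_Im// ltry.
Qed.

Lemma mass_L J : mass L J = J.2%:num `^ (2 + alpha) / (alpha + 1).
Proof.
rewrite /mass /L /den; under eq_integral do rewrite mul1e.
by rewrite integral_box_Im.
Qed.

Lemma mass_L_gt0 J : 0 < mass L J.
Proof. by rewrite mass_L divr_gt0 ?powR_gt0//; have := a1; lra. Qed.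

(** A zero of [sigma] gives [upow] the value 0 and not infinity, by the convention for powers;
    positivity of [sigma] almost everywhere makes such points negligible. *)
Let Upos : {ae leb, forall z, Hplane z -> 0 < U z}%E.
Proof.
have FF := @ae_leb2_filter R.
by apply: filterS spos => z h zH; apply: den_gt0 => //; apply: powR_gt0; exact: h.
Qed.

Lemma tile_U_gt0 J : 0 < tile lson rson (mass U) J.
Proof.
rewrite -lte_fin -(tile_massE _ _ box_density_U); apply: integral_gt0 => //.
- exact: measurable_top.
- by move=> z /sub_top_box /box_Hplane.
- exact: leb2_top_gt0.
Qed.

Lemma mass_U_gt0 J : 0 < mass U J.
Proof.
apply: lt_le_trans (tile_U_gt0 J) _; rewrite /tile.
have := mass_ge0 _ (lson J) box_density_U; have := mass_ge0 _ (rson J) box_density_U; lra.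
Qed.

Lemma Cpq_le J :
  ((mass L J `^ (gamma / (2 + alpha) - 1))%:E *
    (\int[leb]_(z in box J) W z) `^ (q^-1) *
    (mass U J `^ (conj_exp p)^-1)%:E <= c%:E)%E.
Proof.
rewrite -hC; apply: ereal_sup_ubound; exists J.1, (J.1 + J.2%:num)%R; split=> //.
rewrite -!poweR_EFin -(massE _ _ box_density_L) -(massE _ _ box_density_U).
rewrite -(integral_QI L)//; [|by case: box_density_L..].
by rewrite -(integral_QI W)// -(integral_QI U).
Qed.

(** The other two factors of the [C_(p,q)] product are positive, so an infinite [omega]-mass would
    make [c] infinite. *)
Lemma box_density_W : box_density W.
Proof.
split=> // J; rewrite ltey; apply/eqP => E; have := Cpq_le J.
have q0 : 0 < q by have := p1; have := pq; lra.
rewrite E poweRyr ?gt_eqF ?invr_gt0// gt0_muley ?gt0_mulye ?lte_fin ?powR_gt0//.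
- exact: mass_U_gt0.
- exact: mass_L_gt0.
Qed.

(** This part of the fractional normalisation decreases down the tree because [gamma] is
    nonnegative; what remains of [favg] is a genuine average. *)
Definition hscale J : R := J.2%:num `^ gamma / (alpha + 1).

Definition favg J : R := hscale J * mass A J / mass L J.

Lemma favgE J : favg J = J.2%:num `^ (- (2 + alpha - gamma)) * mass A J.
Proof.
have h0 : 0 < J.2%:num by [].
rewrite /favg /hscale mass_L.
have -> : - (2 + alpha - gamma) = gamma - (2 + alpha) by ring.
rewrite powRB ?(gt_eqF h0) ?implybT//; field.
by rewrite !gt_eqF ?powR_gt0//; have := a1; lra.
Qed.

(** The ratio between the power of the area used in [Cpq] and the power of the side used in
    [Mag]. *)
Let k0 := (alpha + 1)^-1 `^ (gamma / (2 + alpha) - 1).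

Lemma testing J : mass W J * favg J `^ q <=
  (c / k0) `^ q * n `^ (q - p) * phi p (mass A J) (mass U J).
Proof.
have h0 : 0 < J.2%:num by [].
have k00 : 0 < k0 by rewrite powR_gt0// invr_gt0; have := a1; lra.
rewrite favgE; apply: testing_real => //.
- exact: mass_ge0 box_density_W.
- exact: mass_U_gt0.
- exact: mass_ge0 box_density_A.
- exact: ltW.
- apply: le_trans (mass_F_le J); apply: phi_integral => //.
  + exact: measurable_box.
  + exact: box_Hplane.
  + by case: box_density_F.
  + by rewrite (massE _ _ box_density_U) lte_fin mass_U_gt0.
  + by case: box_density_U.
- have := Cpq_le J; rewrite (massE _ _ box_density_W) -!EFinM lee_fin.
  suff -> : mass L J `^ (gamma / (2 + alpha) - 1) = k0 * J.2%:num `^ (- (2 + alpha - gamma)) by [].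
  have a10 : 0 <= (alpha + 1)^-1 by rewrite invr_ge0; have := a1; lra.
  rewrite mass_L powRM ?powR_ge0// mulrC; congr (_ * _); rewrite -powRrM; congr (_ `^ _).
  by field; rewrite gt_eqF//; have := a1; lra.
Qed.

(** The average of [u] in the normalisation of [Ma], by [|I|^(2 + alpha)] instead of the area. *)
Let uavg J : R := (alpha + 1)^-1 * (mass U J / mass L J).

Lemma uavg_le_Ma J I z : box I `<=` box J -> box I z ->
  ((uavg I)%:E <= Ma alpha (fun z => (upow p sigma z * \1_(QI J.1 (J.1 + J.2%:num)) z)%R) z)%E.
Proof.
move=> IJ Iz; have h0 : 0 < I.2%:num by [].
set Q := QI _ _.
pose x := ((I.2%:num `^ (- (2 + alpha - 0)))%:E *
  intV alpha (QI I.1 (I.1 + I.2%:num)) (fun w => `|upow p sigma w * \1_Q w|%:E))%E.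
apply: (@le_trans _ _ x); last first.
  apply: ereal_sup_ubound; exists I.1, (I.1 + I.2%:num)%R; split=> //; split.
    exact: box_sub_QI.
  by rewrite addrAC subrr add0r.
have -> : uavg I = I.2%:num `^ (- (2 + alpha - 0)) * mass U I.
  rewrite /uavg mass_L subr0 powRN; field.
  by rewrite !gt_eqF ?powR_gt0//; have := a1; lra.
rewrite EFinM lee_wpmul2l ?lee_fin ?powR_ge0// -(massE _ _ box_density_U).
apply: ge0_subset_integral_nonmeas => //.
- exact: box_sub_QI.
- by move=> w _; rewrite mule_ge0 ?lee_fin ?powR_ge0 ?normr_ge0.
- move=> w Iw; rewrite /U /den indicE mem_set ?mulr1 ?ger0_norm ?powR_ge0//.
  by apply: box_sub_QI; exact: IJ.
Qed.

(** The left side integrates a truncated dyadic maximal function of [u], which is at most [Ma] of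
    [u] cut to [QI], because only boxes inside [J] occur. The numerator of [Bratio] dominates it. *)
Lemma Binf_dysum J d :
  dysum lson rson (mass L) uavg d J 0 <= B * mass U J.
Proof.
set Q := QI J.1 (J.1 + J.2%:num).
have QU : (intV alpha Q (fun z => (upow p sigma z)%:E) = (mass U J)%:E)%E.
  by rewrite intV_den integral_QI// massE//; exact: box_density_U.
have := Bratio_le J; rewrite /Bratio QU /= lee_pdivrMr ?mass_U_gt0// -EFinM => hb.
rewrite -lee_fin; apply: le_trans hb.
have [mL L0 fL] := box_density_L.
rewrite -integral_dymax//; first last.
- by move=> z /box_Hplane; exact: L0.
- by apply: box_density_mfun box_density_L _; exact: box_Hplane.
have uavg0 I : 0 <= uavg I.
  by rewrite !mulr_ge0 ?invr_ge0 ?(ltW (mass_L_gt0 _)) ?(ltW (mass_U_gt0 _))//; have := a1; lra.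
have Ma0 z w : Q z -> (0 <= Ma alpha w z)%E.
  move=> zQ; pose x := (((J.1 + J.2%:num - J.1) `^ (- (2 + alpha - 0)))%:E *
    intV alpha Q (fun y => `|w y|%:E))%E.
  apply: (@le_trans _ _ x); last first.
    by apply: ereal_sup_ubound; exists J.1, (J.1 + J.2%:num)%R.
  rewrite mule_ge0 ?lee_fin ?powR_ge0//.
  by apply: integral_ge0 => y _; rewrite mule_ge0 ?lee_fin ?powR_ge0 ?normr_ge0.
apply: ge0_subset_integral_nonmeas.
- exact: box_sub_QI.
- move=> z zJ; rewrite mule_ge0 ?lee_fin; [by []|exact: dymax_ge_mu|].
  by apply: L0; exact: box_Hplane zJ.
- by move=> z zQ; rewrite mule_ge0 ?lee_fin ?powR_ge0// Ma0.
- move=> z zJ; rewrite /L /den mul1e lee_wpmul2r ?lee_fin ?powR_ge0//.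
  have Mz := Ma0 z (fun z => upow p sigma z * \1_Q z) (box_sub_QI _ _ zJ).
  have uM I := uavg_le_Ma J I z.
  move: Mz uM; rewrite -/Q; case: (Ma _ _ z) => [r|_ _|//]; last by rewrite leey.
  rewrite !lee_fin => r0 uM; exact: dymax_le.
Qed.

(** The factors come from [dysum_le_stopsum], [testing] and [carleson_embedding]; in the last one
    the Carleson constant [2 * (alpha + 1) * B] is stripped of [B]. *)
Definition tree_const : R :=
  2 `^ q * (k0^-1 `^ q * (2 `^ p * (2 * (alpha + 1)) / (p - 1))).

Let k0_gt0 : 0 < k0.
Proof. by rewrite powR_gt0// invr_gt0; have := a1; lra. Qed.

Lemma tree_const_gt0 : 0 < tree_const.
Proof.
rewrite !mulr_gt0 ?powR_gt0 ?invr_gt0//; first by have := a1; lra.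
by have := p1; lra.
Qed.

Lemma Cpq_ge0 : 0 <= c.
Proof.
rewrite -lee_fin; apply: le_trans (Cpq_le (0, PosNum ltr01)).
by rewrite !mule_ge0 ?lee_fin ?powR_ge0 ?poweR_ge0.
Qed.

(** Depth 0 of [Binf_dysum] already forces [B] to be at least [1 / (alpha + 1)]. *)
Lemma Binf_gt0 : 0 < B.
Proof.
pose J : node := (0, PosNum ltr01); have /= h := Binf_dysum J 0%N.
have m0 := mass_L_gt0 J; have u0 := mass_U_gt0 J.
have : (alpha + 1)^-1 * mass U J <= B * mass U J.
  apply: le_trans h; rewrite -ler_pdivrMl// le_max; apply/orP; right.
  by rewrite /uavg mulrC mulrA.
rewrite ler_pM2r//; apply: lt_le_trans; rewrite invr_gt0; have := a1; lra.
Qed.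

Lemma integral_dymax_bound J d :
  (\int[leb]_(z in box J) ((dymax (fun I => favg I `^ q) d J 0 z)%:E * W z)
    <= (tree_const * (c `^ q * B * n `^ q))%:E)%E.
Proof.
have [mW' _ fW] := box_density_W.
have q0 : 0 < q by have := p1; have := pq; lra.
have B0 := Binf_gt0; have c0 := Cpq_ge0.
have al0 : 0 < alpha + 1 by have := a1; lra.
have hl (I : node) : I.2%:num / 2 <= I.2%:num by have : 0 < I.2%:num by []; lra.
have hs0 I : 0 <= hscale I by rewrite divr_ge0 ?powR_ge0// ltW.
have hsl I I' : I'.2%:num <= I.2%:num -> hscale I' <= hscale I.
  move=> II'; rewrite ler_wpM2r ?invr_ge0 ?(ltW al0)//.
  by apply: ge0_ler_powR; rewrite ?nnegrE.
rewrite integral_dymax//; first last.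
- by move=> z /box_Hplane; exact: W0.
- by apply: box_density_mfun box_density_W _; exact: box_Hplane.
(* The 2 comes from sparseness, and [alpha + 1] undoes the normalisation of [uavg]. *)
rewrite lee_fin; pose K := 2 * (alpha + 1) * B.
have K0 : 0 < K by rewrite !mulr_gt0.
have D0 : 0 <= (c / k0) `^ q * n `^ (q - p) by rewrite mulr_ge0 ?powR_ge0.
have := @dysum_power_bound R node lson rson hscale (mass A) (mass L) (mass U) (mass W)
  (mass F) p q K _ d J p1 q0 K0 D0.
move=> /(_ mass_L_gt0 (superadd_mass _ box_density_L)).
move=> /(_ (fun I => mass_ge0 _ I box_density_A) (superadd_mass _ box_density_A) hs0).
move=> /(_ (fun I => hsl I (lson I) (hl I)) (fun I => hsl I (rson I) (hl I))).
move=> /(_ mass_U_gt0 tile_U_gt0).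
(* Hoelder's inequality is needed on whole boxes and, for the Bellman step, on their upper
   halves. *)
have fin (E : set (R * R)) I : measurable E -> E `<=` box I -> (0 < \int[leb]_(z in E) U z)%E ->
    phi p (fine (\int[leb]_(z in E) A z)%E) (fine (\int[leb]_(z in E) U z)%E) <=
    fine (\int[leb]_(z in E) F z)%E.
  move=> mE EI EU.
  have lt (g : R * R -> \bar R) : box_density g -> (\int[leb]_(z in E) g z < +oo)%E.
    move=> bg; have [mg g0' fg] := bg; apply: le_lt_trans (fg I).
    apply: ge0_subset_integral => //; first exact: measurable_box.
      by apply: box_density_mfun bg _; exact: box_Hplane.
    by move=> z /box_Hplane; exact: g0'.
  apply: phi_integral => //.
  + by apply: subset_trans EI _; exact: box_Hplane.
  + exact: lt box_density_F.
  + exact: lt box_density_U.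
have P1 I : phi p (mass A I) (mass U I) <= mass F I.
  apply: (fin _ I) => //; first exact: measurable_box.
  by rewrite (massE _ _ box_density_U) lte_fin mass_U_gt0.
have P2 I : phi p (tile lson rson (mass A) I) (tile lson rson (mass U) I) <=
    tile lson rson (mass F) I.
  have := fin (top I) I (measurable_top _) (@sub_top_box _ I).
  rewrite (tile_massE _ _ box_density_A) (tile_massE _ _ box_density_U).
  by rewrite (tile_massE _ _ box_density_F) lte_fin; apply; exact: tile_U_gt0.
move=> /(_ P1 P2 (fun I => mass_ge0 _ I box_density_W) (superadd_mass _ box_density_W)).
have CK d' I : 2 * dysum lson rson (mass L) (fun I => mass U I / mass L I) d' I 0 <= K * mass U I.
  have := Binf_dysum I d'; have a0' : 0 <= (alpha + 1)^-1 by rewrite invr_ge0 ltW.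
  have := dysumZ lson rson (mass L) (fun I => mass U I / mass L I) _ d' I 0 a0'.
  rewrite mulr0 => ->; rewrite ler_pdivrMl// /K; lra.
move=> /(_ CK testing) h; apply: le_trans h _.
have Fn := mass_F_le J.
have -> : tree_const * (c `^ q * B * n `^ q) =
  2 `^ q * ((c / k0) `^ q * n `^ (q - p) * (2 `^ p * K / (p - 1) * n `^ p)).
  have -> : n `^ q = n `^ (q - p) * n `^ p.
    by rewrite -powRD ?subrK// (gt_eqF n0) implybT.
  have -> : (c / k0) `^ q = c `^ q * k0^-1 `^ q by rewrite powRM// invr_ge0 ltW.
  by rewrite /tree_const /K; ring.
have k1 : 0 <= 2 `^ p * K / (p - 1).
  by rewrite divr_ge0 ?(mulr_ge0 _ (ltW K0)) ?powR_ge0//; have := p1; lra.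
by rewrite ler_wpM2l ?powR_ge0// ler_wpM2l// ler_wpM2l.
Qed.

End Setting.

(** * From truncated dyadic maximal functions to [Mag] *)

Section Fatou.
Context {R : realType}.
Local Notation leb := (@leb2 R).
Local Notation node := (R * {posnum R})%type.

Lemma limn_einfE (u : (\bar R)^nat) : limn_einf u = ereal_sup (range (einfs u)).
Proof. by rewrite limn_einf_lim; apply: cvg_lim => //; exact: cvg_einfs_sup. Qed.

Lemma limn_einf_ge (u : (\bar R)^nat) x N :
  (forall n, (N <= n)%N -> x <= u n)%E -> (x <= limn_einf u)%E.
Proof.
move=> xu; rewrite limn_einfE; apply: (@le_trans _ _ (einfs u N)).
  by apply/ereal_infP => _ [n /= Nn <-]; exact: xu.
by apply: ereal_sup_ubound; exists N.
Qed.

Lemma limn_einf_le (u : (\bar R)^nat) x :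
  (forall n, u n <= x)%E -> (limn_einf u <= x)%E.
Proof.
move=> ux; rewrite limn_einfE; apply: ge_ereal_sup => _ [n _ <-].
apply: le_trans (ux n); apply: ereal_inf_lbound; exists n => //=.
Qed.

Lemma large_scale (x y : R) : x < y -> exists N0, forall N, (N0 <= N)%N ->
  [/\ - (2 ^+ N / 3) <= x, y < 2 ^+ N, 3 * (y - x) < 2 ^+ N.+1 & (2 ^+ N)^-1 <= 3 * (y - x)].
Proof.
move=> xy; pose M := 3 * `|x| + `|y| + 3 * (y - x) + (3 * (y - x))^-1.
have l0 : 0 < 3 * (y - x) by lra.
have l1 : 0 < (3 * (y - x))^-1 by rewrite invr_gt0.
have M0 : 0 <= M.
  by rewrite /M; have := normr_ge0 x; have := normr_ge0 y; lra.
exists (Num.bound M) => N hN.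
have MN : M < 2 ^+ N.
  apply: (lt_le_trans (archi_boundP M0)); rewrite -natrX ler_nat.
  by apply: leq_trans hN _; exact/ltnW/ltn_expl.
have := ler_norm y; have := ler_norm (- x); rewrite normrN => h1 h2.
have := normr_ge0 x; have := normr_ge0 y; rewrite /M in MN => h3 h4.
have z0 : 0 < 2 ^+ N :> R by rewrite exprn_gt0.
rewrite exprS; split; try lra.
by rewrite -[leRHS]invrK lef_pV2 ?posrE//; lra.
Qed.

Variables (alpha gamma q : R) (omega f : R * R -> R) (C : R).
Hypotheses (g1 : gamma < 2 + alpha) (q0 : 0 < q).
Hypothesis omega0 : forall z, Hplane z -> 0 <= omega z.
Hypothesis momega : measurable_fun (@Hplane R) omega.

Let A := den alpha (fun z => `|f z|).
Let W := den alpha omega.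
Let s := 2 + alpha - gamma.
Let a (J : node) := J.2%:num `^ (- s) * mass A J.

Hypothesis bA : box_density A.
Hypothesis bound : forall J d,
  (\int[leb]_(z in box J) ((dymax (fun I => a I `^ q) d J 0 z)%:E * W z) <= C%:E)%E.

(** A covering dyadic interval is at most 6 times longer, which costs [6 ^ s] in the normalisation
    by the length to the power [-s]. *)
Let K := (6 `^ s) `^ q.
Let G N i z := (((fun z => (dymax (fun I => a I `^ q) N.*2 (grid_root N i) 0 z)%:E * W z)
  \_ (box (grid_root N i))) z)%E.
Let Fn N z := (K%:E * (G N true z + G N false z))%E.

Let s0 : 0 < s. Proof. by rewrite /s; have := g1; lra. Qed.
Let K0 : 0 <= K. Proof. exact: powR_ge0. Qed.

Let W0 z : Hplane z -> (0 <= W z)%E.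
Proof. by move=> zH; apply: den_ge0; exact: omega0. Qed.

Let G0 N i z : (0 <= G N i z)%E.
Proof.
rewrite /G /patch; case: ifPn => // /set_mem /box_Hplane zH.
by rewrite mule_ge0 ?W0 ?lee_fin ?dymax_ge_mu.
Qed.

Let mG N i : measurable_fun (@Hplane R) (G N i).
Proof.
apply: (measurable_restrict _ (measurable_box (grid_root N i)) (@measurable_Hplane R)).1.
apply: emeasurable_funM.
  by apply/measurable_EFinP; apply: measurable_funTS; exact: measurable_dymax.
apply: measurable_funS (measurable_den alpha _ momega); first exact: measurable_Hplane.
by move=> z [].
Qed.

Let intG N i : (\int[leb]_(z in @Hplane R) G N i z <= C%:E)%E.
Proof.
apply: le_trans (bound (grid_root N i) N.*2).
rewrite /G; rewrite le_eqVlt; apply/orP; left; apply/eqP.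
rewrite -[in RHS](setIidr (@box_Hplane R (grid_root N i))).
by rewrite /leb2 [RHS]integral_mkcondr.
Qed.

Let intFn N : (\int[leb]_(z in @Hplane R) Fn N z <= (K * (2 * C))%:E)%E.
Proof.
have mH := @measurable_Hplane R.
rewrite /leb2 /Fn ge0_integralZl_EFin//; first last.
- by apply: emeasurable_funD; exact: mG.
- by move=> z _; rewrite adde_ge0 ?G0.
rewrite ge0_integralD; [|exact: mH|by move=> z _; exact: G0|exact: mG|
  by move=> z _; exact: G0|exact: mG].
rewrite EFinM lee_wpmul2l ?lee_fin// [(2 * C)%R](_ : _ = C + C); last by ring.
by rewrite EFinD leeD//; exact: intG.
Qed.

(** Each average is captured once the roots are large and the depth is sufficient. The threshold
    depends on the interval, hence the lower limit in the sequel. *)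
Let point (x y : R) z : x < y -> QI x y z -> exists N0, forall N, (N0 <= N)%N ->
  ((((y - x) `^ (- s) * fine (\int[leb]_(w in QI x y) A w)%E) `^ q)%:E * W z <= Fn N z)%E.
Proof.
move=> xy zQ; have [N0 hN0] := large_scale x y xy; exists N0 => N /hN0[h1 h2 h3 h4].
have [i [j [I [jN dI Ix yI hI]]]] := grid_cover N x y xy h1 h2 h3 h4.
have [/andP[zx zy] /andP[z20 z2]] := zQ.
have zI : box I z.
  by apply/boxP; rewrite (le_trans Ix zx) (le_lt_trans zy yI) z20; split=> //=; lra.
have zJ := desc_sub _ _ _ dI _ zI.
have QIsub : QI x y `<=` box I.
  move=> w [/andP[w1 w2] /andP[w3 w4]]; apply/boxP.
  by rewrite (le_trans Ix w1) (le_lt_trans w2 yI) w3; split=> //=; lra.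
have Wz : (0 <= W z)%E by apply: W0; exact: box_Hplane zI.
have GI : ((a I `^ q)%:E * W z <= G N i z)%E.
  rewrite /G /patch mem_set// lee_wpmul2r// lee_fin.
  exact: (dymax_desc (fun I => a I `^ q) _ _ _ _ _ _ jN dI zI).
have yx0 : 0 <= y - x by lra.
have v0 : 0 <= fine (\int[leb]_(w in QI x y) A w)%E.
  by apply: fine_ge0; apply: integral_ge0 => w _; exact: den_ge0.
have vI : (y - x) `^ (- s) * fine (\int[leb]_(w in QI x y) A w)%E <= 6 `^ s * a I.
  have m1 : fine (\int[leb]_(w in QI x y) A w)%E <= mass A I.
    have le : (\int[leb]_(w in QI x y) A w <= \int[leb]_(w in box I) A w)%E.
      apply: ge0_subset_integral => //; [exact: measurable_QI|exact: measurable_box| |].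
        by apply: box_density_mfun bA _; exact: box_Hplane.
      by move=> w _; exact: den_ge0.
    apply: fine_le => //; last by rewrite (massE _ _ bA).
    rewrite ge0_fin_numE; last by apply: integral_ge0 => w _; exact: den_ge0.
    by apply: le_lt_trans le _; rewrite (massE _ _ bA) ltry.
  rewrite /a mulrA; apply: ler_pM => //; first exact: powR_ge0.
  have hI0 : 0 < I.2%:num by [].
  have yx : 0 < y - x by rewrite subr_gt0.
  rewrite !powRN ler_pdivlMr ?powR_gt0// ler_pdivrMl ?powR_gt0// mulrC -powRM//.
  by apply: ge0_ler_powR; rewrite ?nnegrE ?mulr_ge0// ltW.
have vq : ((y - x) `^ (- s) * fine (\int[leb]_(w in QI x y) A w)%E) `^ q <= K * a I `^ q.
  have aI0 : 0 <= a I by rewrite mulr_ge0 ?powR_ge0 ?mass_ge0.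
  rewrite /K -powRM ?powR_ge0//; apply: ge0_ler_powR; rewrite ?nnegrE ?(ltW q0)//.
    by rewrite mulr_ge0 ?powR_ge0.
  by rewrite mulr_ge0 ?powR_ge0.
apply: (@le_trans _ _ ((K * a I `^ q)%:E * W z)%E).
  by rewrite lee_wpmul2r// lee_fin.
rewrite EFinM -muleA /Fn lee_wpmul2l ?lee_fin//; apply: le_trans GI _.
by case: i {dI zJ} => /=; [exact: leeDl|exact: leeDr].
Qed.

Lemma Mag_integral_le :
  (intV alpha (@Hplane R) (fun z => `|Mag alpha gamma f z| `^ q * (omega z)%:E)
    <= (K * (2 * C))%:E)%E.
Proof.
have mH := @measurable_Hplane R.
have Fn0 N z : (0 <= Fn N z)%E by rewrite mule_ge0 ?lee_fin// adde_ge0.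
have mFn N : measurable_fun (@Hplane R) (Fn N).
  apply: emeasurable_funM; first exact: measurable_cst.
  by apply: emeasurable_funD; exact: mG.
apply: (@le_trans _ _ (\int[leb]_(z in @Hplane R) limn_einf (Fn ^~ z))%E); last first.
  apply: le_trans (_ : limn_einf (fun n => \int[leb]_(z in @Hplane R) Fn n z)%E <= _)%E.
    by apply: fatou.
  by apply: limn_einf_le => N; exact: intFn.
apply: ge0_le_integral_nonmeas => z zH.
  by rewrite !mule_ge0 ?poweR_ge0 ?lee_fin ?powR_ge0// omega0.
set l := limn_einf _; have l0 : (0 <= l)%E by apply: (limn_einf_ge _ _ 0%N) => n _.
(* Here [Mag] may be infinite, but its product with 0 is 0; elsewhere one can divide by the density
   [w]. *)
have [e|] := eqVneq (omega z) 0; first by rewrite e mule0 mul0e.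
move=> wn0; have wz : 0 < omega z by rewrite lt_neqAle eq_sym wn0 omega0.
have z2 : 0 < z.2 `^ alpha by rewrite powR_gt0.
pose w := omega z * z.2 `^ alpha; have w0 : 0 < w by rewrite mulr_gt0.
rewrite -muleA -EFinM -/w.
case El : l => [r| |]; [|by rewrite leey|by move: l0; rewrite El].
have r0 : 0 <= r by move: l0; rewrite El lee_fin.
have rw : 0 <= r / w by rewrite divr_ge0// ltW.
pose M := (r / w) `^ q^-1.
(* An explicit box around [z]: the supremum defining [Mag] is over a nonempty family, hence
   nonnegative. *)
have zQ : QI z.1 (z.1 + z.2 + 1) z.
  rewrite /QI /=; move: zH; rewrite /Hplane /= => zH.
  by split; apply/andP; split; lra.
have Mag0 : (0 <= Mag alpha gamma f z)%E.
  pose x := (((z.1 + z.2 + 1 - z.1) `^ (- (2 + alpha - gamma)))%:E *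
    intV alpha (QI z.1 (z.1 + z.2 + 1)) (fun y => `|f y|%:E))%E.
  apply: (@le_trans _ _ x).
    rewrite mule_ge0 ?lee_fin ?powR_ge0//.
    by apply: integral_ge0 => y _; rewrite mule_ge0 ?lee_fin ?powR_ge0 ?normr_ge0.
  apply: ereal_sup_ubound; exists z.1, (z.1 + z.2 + 1); split=> //.
  by move: zH; rewrite /Hplane /=; lra.
rewrite gee0_abs//.
have MagM : (Mag alpha gamma f z <= M%:E)%E.
  apply: ge_ereal_sup => _ [x [y [xy [zxy ->]]]].
  have [N0 hN] := point x y z xy zxy.
  have [N [i [j [I [_ _ Ix yI _]]]]] : exists N i j I, [/\ (j <= N.*2)%N, desc j (grid_root N i) I, I.1 <= x,
    y < I.1 + I.2%:num & I.2%:num <= 6 * (y - x)].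
    have [N1 hN1] := large_scale x y xy; exists N1.
    by have [h1 h2 h3 h4] := hN1 _ (leqnn _); exact: grid_cover.
  have QIsub : QI x y `<=` box I.
    move=> t [/andP[w1 w2] /andP[w3 w4]]; apply/boxP.
    by rewrite (le_trans Ix w1) (le_lt_trans w2 yI) w3; split=> //=; lra.
  have fin : (\int[leb]_(t in QI x y) A t \is a fin_num)%E.
    rewrite ge0_fin_numE; last by apply: integral_ge0 => t _; exact: den_ge0.
    apply: (@le_lt_trans _ _ (\int[leb]_(t in box I) A t)%E).
      apply: ge0_subset_integral => //; [exact: measurable_QI|exact: measurable_box| |].
        by apply: box_density_mfun bA _; exact: box_Hplane.
      by move=> t _; exact: den_ge0.
    by rewrite (massE _ _ bA) ltry.
  rewrite intV_den -/A -(fineK fin) -EFinM lee_fin.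
  have WE : W z = w%:E by [].
  have := limn_einf_ge _ _ _ hN; rewrite -/l El WE; set v := (_ * fine _)%R.
  have -> : ((v `^ q)%:E * w%:E = (v `^ q * w)%:E)%E by [].
  rewrite lee_fin => vr.
  have v0 : 0 <= v.
    rewrite mulr_ge0 ?powR_ge0//; apply: fine_ge0; apply: integral_ge0 => t _; exact: den_ge0.
  have -> : v = (v `^ q) `^ q^-1 by rewrite -powRrM mulfV ?powRr1// gt_eqF.
  rewrite /M.
  apply: ge0_ler_powR; rewrite ?nnegrE ?powR_ge0 ?invr_ge0 ?(ltW q0)//.
  by rewrite ler_pdivlMr.
have : (Mag alpha gamma f z `^ q <= (r / w)%:E)%E.
  apply: (@le_trans _ _ (M%:E `^ q)%E).
    by apply: gt0_ler_poweR; rewrite ?in_itv/= ?leey ?(ltW q0) ?lee_fin ?powR_ge0 ?andbT.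
  by rewrite poweR_EFin /M -powRrM mulVf ?gt_eqF// powRr1.
move=> h; apply: (@le_trans _ _ ((r / w)%:E * w%:E)%E).
  by rewrite lee_wpmul2r// lee_fin ltW.
by rewrite -EFinM divfK ?gt_eqF.
Qed.

End Fatou.

(** * The cases where the right-hand side vanishes *)

Section Degenerate.
Context {R : realType}.
Local Notation leb := (@leb2 R).
Variables (alpha gamma p q : R) (sigma omega f : R * R -> R).
Hypotheses (a1 : -1 < alpha) (p1 : 1 < p) (q0 : 0 < q).
Hypotheses (hs : weight alpha sigma) (hw : weight alpha omega).
Hypothesis spos : {ae leb, forall z, Hplane z -> 0 < sigma z}.
Hypothesis mf : measurable_fun (@Hplane R) f.

Let mH := @measurable_Hplane R.
Let msig : measurable_fun (@Hplane R) sigma. Proof. by case: hs => _ []. Qed.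
Let mome : measurable_fun (@Hplane R) omega. Proof. by case: hw => _ []. Qed.
Let W0 z : Hplane z -> (0 <= den alpha omega z)%E.
Proof. by move=> zH; apply: den_ge0; case: hw => + _; exact. Qed.
Let A0 z : (0 <= den alpha (fun w => (`|f w|)%R) z)%E. Proof. exact: den_ge0. Qed.

(** Since [sigma] is positive almost everywhere, [f] vanishes almost everywhere, and then every
    average is exactly 0. *)
Lemma norm_eq0_Mag : norm alpha p (fun z => sigma z * f z) = 0%E ->
  wnorm alpha q omega (Mag alpha gamma f) = 0%E.
Proof.
pose F := den alpha (fun z => `|sigma z * f z| `^ p); pose A := den alpha (fun z => `|f z|).
have F0 z : (0 <= F z)%E by apply: den_ge0; exact: powR_ge0.
have mF : measurable_fun (@Hplane R) F by apply: measurable_den; exact: measurable_sfp.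
have mA : measurable_fun (@Hplane R) A by apply: measurable_den; exact: measurable_absf.
pose mu : {measure set _ -> \bar R} := ((@lebesgue_measure R) \x (@lebesgue_measure R))%E.
move=> N0; have IF0 : (\int[mu]_(z in @Hplane R) F z = 0)%E.
  by apply: poweR_eq0_eq0 N0; apply: integral_ge0 => z _; exact: F0.
have absE g : (forall z, 0 <= g z)%E ->
    (\int[mu]_(z in @Hplane R) `|g z| = \int[mu]_(z in @Hplane R) g z)%E.
  by move=> g0; apply: eq_integral => z _; rewrite gee0_abs.
have Fz : ae_eq leb (@Hplane R) F (cst 0%E).
  by apply/(@ae_eq_integral_abs _ _ _ mu _ mH F mF); rewrite absE.
have FF := @ae_leb2_filter R.
have Az : ae_eq leb (@Hplane R) A (cst 0%E).
  apply: filterS2 spos Fz => z h1 h2 zH; have s0 := h1 zH; have := h2 zH.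
  have y0 : 0 < z.2 `^ alpha by rewrite powR_gt0.
  rewrite /F /A /den -!EFinM => -[] /eqP; rewrite mulf_eq0 (gt_eqF y0) orbF powR_eq0.
  by rewrite normr_eq0 mulf_eq0 (gt_eqF s0) /= => /andP[/eqP -> _]; rewrite normr0 mul0r.
have IA : (\int[mu]_(z in @Hplane R) A z = 0)%E.
  by rewrite -absE//; apply/(@ae_eq_integral_abs _ _ _ mu _ mH A mA).
have M0 z : Hplane z -> Mag alpha gamma f z = 0%E.
  move=> zH.
  have E x y : (((y - x) `^ (- (2 + alpha - gamma)))%:E *
      intV alpha (QI x y) (fun w => `|f w|%:E) = 0)%E.
    suff -> : intV alpha (QI x y) (fun w => `|f w|%:E) = 0%E by rewrite mule0.
    apply/eqP; rewrite eq_le; apply/andP; split; last by apply: integral_ge0 => w _; exact: A0.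
    rewrite -IA; apply: ge0_subset_integral.
    - exact: measurable_QI.
    - exact: mH.
    - exact: mA.
    - by move=> w _; exact: A0.
    - exact: QI_Hplane.
  apply/eqP; rewrite eq_le; apply/andP; split.
    by apply: ge_ereal_sup => _ [x [y [_ [_ ->]]]]; rewrite E.
  apply: ereal_sup_ubound; exists z.1, (z.1 + z.2 + 1); rewrite E; split.
    by move: zH; rewrite /Hplane /=; lra.
  by split=> //; rewrite /QI /=; move: zH; rewrite /Hplane /= => zH; split; apply/andP; split; lra.
rewrite /wnorm /intV integral0_eq ?poweR0r ?gt_eqF ?invr_gt0// => z zH.
by rewrite M0// abse0 poweR0r ?gt_eqF// !mul0e.
Qed.

(** The factors from [u] and from the area are positive, so [omega] has mass 0 on every box, hence
    on the half-plane by exhaustion. *)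
Lemma Cpq_eq0_Mag : Cpq alpha gamma p q sigma omega = 0%E ->
  wnorm alpha q omega (Mag alpha gamma f) = 0%E.
Proof.
move=> C0; pose W := den alpha omega; pose U := den alpha (upow p sigma).
have mW : measurable_fun (@Hplane R) W by exact: measurable_den.
have mU : measurable_fun (@Hplane R) U by apply: measurable_den; exact: measurable_upow.
have U0 z : (0 <= U z)%E by apply: den_ge0; exact: powR_ge0.
have FF := @ae_leb2_filter R.
have Upos : {ae leb, forall z, Hplane z -> 0 < U z}%E.
  by apply: filterS spos => z h zH; apply: den_gt0 => //; apply: powR_gt0; exact: h.
have W00 J : (\int[leb]_(z in box J) W z = 0)%E.
  pose QJ := QI J.1 (J.1 + J.2%:num).
  have QU : (0 < \int[leb]_(z in QJ) U z)%E.
    apply: (@lt_le_trans _ _ (\int[leb]_(z in top J) U z)%E).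
      apply: integral_gt0 => //; [exact: measurable_top| |exact: leb2_top_gt0].
      by move=> z /sub_top_box /box_Hplane.
    apply: ge0_subset_integral => //; [exact: measurable_top|exact: measurable_QI| |].
      by apply: measurable_funS mU => //; exact: QI_Hplane.
    by apply: subset_trans (@sub_top_box _ J) _; exact: box_sub_QI.
  have QL : (\int[leb]_(z in QJ) den alpha (fun=> 1%R) z = (mass (den alpha (fun=> 1%R)) J)%:E)%E.
    have bL := box_density_L alpha a1.
    by rewrite integral_QI ?massE//; case: bL.
  have : ((intV alpha QJ (fun _ => 1%E)) `^ (gamma / (2 + alpha) - 1) *
      (intV alpha QJ (fun z => (omega z)%:E)) `^ (q^-1) *
      (intV alpha QJ (fun z => (upow p sigma z)%:E)) `^ ((conj_exp p)^-1) <= 0)%E.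
    by rewrite -C0; apply: ereal_sup_ubound; exists J.1, (J.1 + J.2%:num)%R; rewrite ltrDl.
  rewrite !intV_den -/U -/W -(integral_QI W)// -/QJ => h.
  have X1 : (0 < (intV alpha QJ (fun _ => 1%E)) `^ (gamma / (2 + alpha) - 1))%E.
    by rewrite [intV _ _ _]QL poweR_EFin lte_fin powR_gt0// mass_L_gt0.
  have X3 := poweR_gt0 (conj_exp p)^-1 QU.
  have I0 : (0 <= \int[leb]_(z in QJ) W z)%E by apply: integral_ge0 => z /QI_Hplane; exact: W0.
  apply/eqP; rewrite eq_le I0 andbT leNgt; apply/negP => IW.
  by move: h; rewrite leNgt !mule_gt0// poweR_gt0.
have IW : (\int[leb]_(z in @Hplane R) W z = 0)%E.
  apply/eqP; rewrite eq_le; apply/andP; split; last exact: integral_ge0.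
  pose G N := W \_ (box (grid_root N false)).
  have G0 N z : (0 <= G N z)%E.
    by rewrite /G /patch; case: ifPn => // /set_mem /box_Hplane; exact: W0.
  apply: (@le_trans _ _ (\int[leb]_(z in @Hplane R) limn_einf (G ^~ z))%E).
    apply: ge0_le_integral_nonmeas => // z zH.
    have [|N0 hN0] := @large_scale R z.1 (z.1 + z.2 + 1); first by move: zH; rewrite /Hplane /=; lra.
    apply: (limn_einf_ge _ _ N0) => N /hN0[h1 h2 _ _]; rewrite /G /patch mem_set//.
    have e0 : 0 < 2 ^+ N :> R by rewrite exprn_gt0.
    apply/boxP; move: zH; rewrite /Hplane /= exprS => zH.
    by split; apply/andP; split; lra.
  apply: le_trans (_ : limn_einf (fun n => \int[leb]_(z in @Hplane R) G n z)%E <= _)%E.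
    apply: fatou => // N.
    apply: (measurable_restrict _ (measurable_box (grid_root N false)) mH).1.
    by apply: measurable_funS mW => // z [].
  apply: limn_einf_le => N; rewrite -(W00 (grid_root N false)) le_eqVlt; apply/orP; left; apply/eqP.
  by rewrite -[in RHS](setIidr (@box_Hplane R (grid_root N false))) /leb2 [RHS]integral_mkcondr.
rewrite /wnorm; set I := intV _ _ _; suff -> : I = 0%E by rewrite poweR0r// gt_eqF ?invr_gt0.
have om0 z : Hplane z -> 0 <= omega z by case: hw => + _; exact.
apply/eqP; rewrite eq_le; apply/andP; split; last first.
  by apply: integral_ge0 => z zH; rewrite !mule_ge0 ?poweR_ge0 ?lee_fin ?powR_ge0 ?om0.
(* No control of [Mag] is required: replacing its power by infinity still gives infinity times a
   zero integral, which is 0. *)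
apply: (@le_trans _ _ (\int[leb]_(z in @Hplane R) (+oo * W z))%E).
  apply: ge0_le_integral_nonmeas => z zH.
    by rewrite !mule_ge0 ?poweR_ge0 ?lee_fin ?powR_ge0 ?om0.
  by rewrite -muleA lee_wpmul2r ?W0// leey.
by rewrite /leb2 ge0_integralZl// IW mule0.
Qed.

End Degenerate.

Theorem theorem2p9 (R : realType) (alpha gamma p q : R) :
  -1 < alpha -> 0 <= gamma -> gamma < 2 + alpha -> 1 < p -> p <= q ->
  exists C : R, 0 < C /\
    forall sigma omega f : R * R -> R,
      weight alpha sigma -> weight alpha omega ->
      {ae (@leb2 R), forall z, Hplane z -> (0 < sigma z)%R} ->
      weight alpha (upow p sigma) ->
      measurable_fun (@Hplane R) f ->
      (wnorm alpha q omega (Mag alpha gamma f) <=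
        C%:E * Cpq alpha gamma p q sigma omega *
        (Binf alpha (upow p sigma)) `^ (q^-1) *
        norm alpha p (fun z => (sigma z * f z)%R))%E.
Proof.
move=> a1 g0 g1 p1 pq; have q0 : 0 < q by lra.
have qi0 : q^-1 != 0 by rewrite gt_eqF// invr_gt0.
have tc0 := @tree_const_gt0 R alpha gamma p q a1 p1.
set t := tree_const alpha gamma p q in tc0.
(* The power of 6 is the cost of the covering intervals, and the 2 counts the two grids. *)
pose K := (6 `^ (2 + alpha - gamma)) `^ q * (2 * t).
have K0 : 0 < K by apply: mulr_gt0; [rewrite !powR_gt0 | apply: mulr_gt0 => //; exact: tc0].
exists (K `^ q^-1); split; first exact: powR_gt0.
move=> sigma omega f hs hw spos _ mf.
have [n0|nn0] := eqVneq (norm alpha p (fun z => sigma z * f z)) 0%E.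
  by rewrite (norm_eq0_Mag alpha gamma p q sigma omega f)// n0 mule0.
have [c0|cn0] := eqVneq (Cpq alpha gamma p q sigma omega) 0%E.
  by rewrite (Cpq_eq0_Mag alpha gamma p q sigma omega f)// c0 mule0 !mul0e.
have om0 z : Hplane z -> 0 <= omega z by case: hw => + _; exact.
have ngt0 : (0 < norm alpha p (fun z => (sigma z * f z)%R))%E by rewrite lt0e nn0 poweR_ge0.
have cgt0 : (0 < Cpq alpha gamma p q sigma omega)%E.
  rewrite lt0e cn0; apply: le_trans (ereal_sup_ubound _); last by exists 0, 1; split; [exact: ltr01|reflexivity].
  by rewrite !mule_ge0 ?poweR_ge0.
have Kgt0 : (0 < (K `^ q^-1)%:E)%E by rewrite lte_fin powR_gt0.
(* With all three factors positive, an infinite one makes the right-hand side infinite instead of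
   being absorbed by a zero. The value [-oo] is excluded by one nonnegative [Bratio]. *)
have Bgt0 : (0 < Binf alpha (upow p sigma))%E.
  case E : (Binf alpha (upow p sigma)) => [B| |]; [|by []|].
    by rewrite lte_fin; exact: (Binf_gt0 _ _ _ a1 hs spos _ E).
  have : (Bratio alpha (upow p sigma) 0 1 <= -oo)%E.
    by rewrite -E; apply: ereal_sup_ubound; exists 0, 1.
  rewrite leeNy_eq /Bratio; case: ifPn => // Qy /eqP.
  set x := intV _ _ _; have x0 : (0 <= x)%E.
    apply: integral_ge0 => z zQ; rewrite mule_ge0 ?lee_fin ?powR_ge0//.
    apply: le_trans (ereal_sup_ubound _); last by exists 0, 1; split; [exact: ltr01|split; [exact: zQ|reflexivity]].
    rewrite mule_ge0 ?lee_fin ?powR_ge0//.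
    by apply: integral_ge0 => y _; rewrite mule_ge0 ?lee_fin ?powR_ge0 ?normr_ge0.
  move=> h; have : (0 <= -oo :> \bar R)%E.
    rewrite -h mule_ge0// lee_fin invr_ge0 fine_ge0//.
    by apply: integral_ge0 => y _; rewrite mule_ge0 ?lee_fin ?powR_ge0.
  by [].
case EB : (Binf alpha (upow p sigma)) Bgt0 => [B| |//] Bgt0; last first.
  by rewrite poweRyr// gt0_muley ?mule_gt0// gt0_mulye ?leey.
case EC : (Cpq alpha gamma p q sigma omega) cgt0 => [c| |//] cgt0; last first.
  by rewrite gt0_muley// gt0_mulye ?poweR_gt0// gt0_mulye ?leey.
case EN : (norm alpha p _) ngt0 => [n| |//] ngt0; last first.
  by rewrite gt0_muley ?leey// !mule_gt0 ?poweR_gt0.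
rewrite poweR_EFin -!EFinM; rewrite !lte_fin in Bgt0 cgt0 ngt0.
have bA := box_density_A _ _ _ _ p1 hs spos mf _ _ EB EN.
have mom : measurable_fun (@Hplane R) omega by case: hw => _ [].
have bound := integral_dymax_bound _ _ _ _ _ _ _ a1 g0 p1 pq hs hw spos mf _ _ _ EC EB EN ngt0.
have := @Mag_integral_le R alpha gamma q omega f (t * (c `^ q * B * n `^ q)) g1 q0 om0 mom bA.
have <- : (fun J => favg alpha gamma f J `^ q) =
  (fun J : R * {posnum R} => (J.2%:num `^ (- (2 + alpha - gamma)) *
     mass (den alpha (fun z => `|f z|)) J) `^ q).
  by apply/funext => J; rewrite favgE.
move=> /(_ bound).
have -> : (6 `^ (2 + alpha - gamma)) `^ q * (2 * (t * (c `^ q * B * n `^ q))) =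
   K * c `^ q * B * n `^ q by rewrite /K; ring.
clearbody K => main.
have [[[K1 c1] B1] n1] := (ltW K0, ltW cgt0, ltW Bgt0, ltW ngt0).
rewrite /wnorm; apply: (@le_trans _ _ ((K * c `^ q * B * n `^ q)%:E `^ q^-1)%E).
  apply: gt0_ler_poweR => //; first by rewrite invr_ge0 ltW.
  - rewrite in_itv/= leey andbT; apply: integral_ge0 => z zH.
    by rewrite !mule_ge0 ?poweR_ge0 ?lee_fin ?powR_ge0 ?om0.
  - by rewrite in_itv/= leey andbT lee_fin !mulr_ge0 ?powR_ge0.
rewrite poweR_EFin lee_fin !powRM ?mulr_ge0 ?powR_ge0//.
by rewrite -!(powRrM _ q) !mulfV ?gt_eqF// !powRr1.
Qed.
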